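(* Fix $\alpha\in(0,1)$. For each $n$ let $X_1,\dots,X_n$ be i.i.d. from a distribution $P$ on $\mathbb{R}^d$, where $d=d_n$ and $P=P_n$ may depend on $n$, and let $m_1=m_1(n)$, $m_2=n-m_1$ be positive integers. Suppose that: (a) $P=N(\mu,\Sigma)$; (b) there exist constants $\lambda_\ast,\lambda^\ast>0$ such that the eigenvalues of $\Sigma$ satisfy $\lambda_\ast\le\lambda_1(\Sigma)\le\dots\le\lambda_d(\Sigma)\le\lambda^\ast$; (c) $\mu^\top\mu=O(\sqrt d/n)$; (d) $d/n\to\tau\in(0,\infty)$; (e) $m_1/n\to\kappa\in(0,1)$. Then, as $n\to\infty$, $$\mathbb{E}_P[\phi_{\mathrm{mean}}]=\Phi\left(z_\alpha+\frac{n\sqrt{\kappa(1-\kappa)}\,\mu^\top\mu}{\sqrt{\mathrm{tr}(\Sigma^2)}}\right)+o(1).$$ Therefore the power is asymptotically maximized when $m_1/n\to\kappa=1/2$.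
   Context: $\Phi$ is the cumulative distribution function of $N(0,1)$ and $z_\beta$ its $\beta$-quantile. The constants $\lambda_\ast,\lambda^\ast,\tau,\kappa$ do not depend on $n$. Let $f_{\mathrm{mean}}(x)=\frac1{m_2}\sum_{j=m_1+1}^{n}X_j^\top x$, $\overline f_{\mathrm{mean}}=\frac1{m_1}\sum_{i=1}^{m_1}f_{\mathrm{mean}}(X_i)$, $$T_{\mathrm{mean}}=\frac{\sqrt{m_1}\,\overline f_{\mathrm{mean}}}{\sqrt{m_1^{-1}\sum_{i=1}^{m_1}\{f_{\mathrm{mean}}(X_i)-\overline f_{\mathrm{mean}}\}^2}},$$ and $\phi_{\mathrm{mean}}=\mathbf 1(T_{\mathrm{mean}}>z_{1-\alpha})$. *)

(* Defs.v *)
From HB Require Import structures.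
From mathcomp Require Import all_boot all_order all_algebra.
From mathcomp Require Import all_classical all_reals all_analysis.
Import Order.TTheory GRing.Theory Num.Theory.
Import numFieldNormedType.Exports.

Set Implicit Arguments.
Unset Strict Implicit.
Unset Printing Implicit Defensive.

Local Open Scope classical_set_scope.
Local Open Scope ring_scope.

(* R^d is d.-tuple R, because this type carries the product (Borel)
   sigma-algebra in MathComp-Analysis. *)

Definition dotp (R : realType) (d : nat) (x y : d.-tuple R) : R :=
  \sum_(k < d) tnth x k * tnth y k.

Definition quadform (R : realType) (d : nat) (S : 'M[R]_d) (a : d.-tuple R) : R :=
  \sum_(k < d) \sum_(l < d) tnth a k * S k l * tnth a l.

(* N(m, v) is parametrized by its variance v here, whereas normal_prob takes the
   standard deviation.  The case v = 0 is separate since normal_prob m 0 is not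
   the point mass at m. *)
Definition normal_law (R : realType) (m v : R) (B : set R) : \bar R :=
  if v == 0 then \d_m B else normal_prob m (Num.sqrt v) B.

(* P = N(mu, S): every linear combination of the coordinates has the
   corresponding univariate normal law. *)
Definition is_mvnormal (R : realType) (d : nat)
    (P : probability (d.-tuple R) R) (mu : d.-tuple R) (S : 'M[R]_d) : Prop :=
  [/\ S^T = S,
      forall a : d.-tuple R, 0 <= quadform S a
    & forall (a : d.-tuple R) (B : set R), measurable B ->
        P [set x | B (dotp a x)] = normal_law (dotp a mu) (quadform S a) B].

(* The product rule for subfamilies of the X i follows by taking B i = setT. *)
Definition iid_sample (R : realType) (disp : measure_display)
    (T : measurableType disp) (Pr : probability T R) (n d : nat)
    (X : 'I_n -> {RV Pr >-> d.-tuple R}) (P : probability (d.-tuple R) R) : Prop :=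
  (forall (i : 'I_n) (B : set (d.-tuple R)), measurable B ->
     distribution Pr (X i) B = P B) /\
  (forall B : 'I_n -> set (d.-tuple R), (forall i, measurable (B i)) ->
     Pr (\bigcap_(i in [set: 'I_n]) (X i @^-1` B i)) =
     (\prod_(i < n) Pr (X i @^-1` B i))%E).

Definition Phi (R : realType) (x : R) : R :=
  fine (normal_prob (0 : R) 1 `]-oo, x]).

Definition zquantile (R : realType) (b : R) : R := inf [set x : R | b <= Phi x].

(* Indices start at 0: the first m1 observations are those with i < m1, and
   m2 = n - m1. *)
Definition f_mean (R : realType) (n d m1 : nat) (x : 'I_n -> d.-tuple R)
    (y : d.-tuple R) : R :=
  (n - m1)%:R^-1 * \sum_(j < n | (m1 <= j)%N) dotp (x j) y.

Definition fbar_mean (R : realType) (n d m1 : nat) (x : 'I_n -> d.-tuple R) : R :=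
  m1%:R^-1 * \sum_(i < n | (i < m1)%N) f_mean m1 x (x i).

(* When the denominator vanishes the value is 0, by the convention r / 0 = 0. *)
Definition T_mean (R : realType) (n d m1 : nat) (x : 'I_n -> d.-tuple R) : R :=
  Num.sqrt m1%:R * fbar_mean m1 x /
  Num.sqrt (m1%:R^-1 *
    \sum_(i < n | (i < m1)%N) (f_mean m1 x (x i) - fbar_mean m1 x) ^+ 2).

Definition phi_mean (R : realType) (n d m1 : nat) (x : 'I_n -> d.-tuple R)
    (alpha : R) : R :=
  if zquantile (1 - alpha) < T_mean m1 x then 1 else 0.

Definition power_mean (R : realType) (disp : measure_display)
    (T : measurableType disp) (Pr : probability T R) (n d : nat)
    (X : 'I_n -> {RV Pr >-> d.-tuple R}) (m1 : nat) (alpha : R) : R :=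
  fine 'E_Pr[fun w => phi_mean m1 (fun i => X i w) alpha].

(* Main.v *)
Require Import Defs.
From HB Require Import structures.
From mathcomp Require Import all_boot all_order all_algebra.
From mathcomp Require Import all_classical all_reals all_analysis.
From mathcomp Require Import measurable_realfun normal_distribution.
From mathcomp Require Import ring lra.
Import Order.TTheory GRing.Theory Num.Theory.
Import numFieldNormedType.Exports.

(** Freeze the second sample. Let [W] be the mean of the last [m2] observations.
    Then [f_mean] is the linear form [y |-> <W, y>], so that, for a fixed value
    of [W], the [m1] numbers [f_mean (X_i)] are i.i.d. normal with mean [<W, mu>]
    and variance [b^2 = W^T Sigma W]. Standardizing them,

      [T_mean = (sqrt m1 * <W, mu> / b + N) / s]

    where [N] is the normalized sum of [m1] standard normal variables and [s^2]
    is their empirical variance. The laws of [N] and [s^2] do not depend on the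
    frozen value of [W]; by independence of the two samples
    ([probability_freeze_le]) [N] is standard normal ([standardized_mean_law])
    and [s^2] is close to 1 ([standardized_variance_concentration]) without any
    conditioning.

    The two remaining random quantities depend on [W] only, and [W] is normal
    with mean [mu] and covariance [Sigma / m2]. The numerator satisfies
    [sqrt m1 * <W, mu> = sqrt m1 * mu^T mu + o(1)], since its variance is
    [m1 * mu^T Sigma mu / m2 = O(mu^T mu)], which tends to 0. With [Y = W - mu],
    [b^2 = Y^T Sigma Y + 2 mu^T Sigma Y + mu^T Sigma mu]; the last two terms
    vanish, and the first has mean [c = tr (Sigma^2) / m2], which stays away from
    0, and variance [2 tr (Sigma^4) / m2^2 = O(d / n^2)]. Hence the drift
    [sqrt m1 * <W, mu> / b] is close to
    [delta = sqrt (m1 * m2) * mu^T mu / sqrt (tr (Sigma^2))], the rejection event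
    [T_mean > z] is close to [N > z - delta], and its probability is close to
    [Phi (delta - z)] because [Phi] is Lipschitz. All this is made quantitative
    for a fixed sample size in [rejection_probability_bound], and
    [power_near_limit] replaces [sqrt (m1 * m2)] by its limiting rate
    [n * sqrt (kappa * (1 - kappa))].

    What is needed about normal vectors reduces to one fact: a sum of independent
    real normal variables is normal ([normal_prob_convolution],
    [sample_linear_form_normal]). It gives the law, hence the second and fourth
    moments, of every linear form of the sample, and polarization then yields the
    moments of all products of two and four linear forms ([wick2], [wick4]) and
    the variance of every quadratic form ([wick_quadratic_variance]). This is used
    twice, for [Y^T Sigma Y] and for [s^2]. The eigenvalue bounds enter through
    Rayleigh quotients ([bform_le_eigenvalue]).

    The optimality of [kappa = 1/2] follows from [kappa' * (1 - kappa') <= 1/4]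
    and the monotonicity of [Phi]. *)

Set Implicit Arguments.
Unset Strict Implicit.
Unset Printing Implicit Defensive.
Local Open Scope classical_set_scope.
Local Open Scope ring_scope.

(** * Integrals against normal laws *)

Section NormalIntegrals.
Variable R : realType.
Implicit Types (m s u x y : R) (B : set R).
Local Notation leb := (@lebesgue_measure R).

Lemma measurable_addl u : measurable_fun [set: R] (fun x : R => u + x).
Proof. exact: measurable_funD. Qed.

Lemma lebesgue_measure_addl u B : measurable B ->
  pushforward leb ((fun x => u + x) : _ -> measurableTypeR R) B = leb B.
Proof.
move=> mB; apply/esym/lebesgue_measure_unique => //=; first exact: measurable_addl. move=> _.
move=> _ [[a b]] _ <-; rewrite /pushforward.
rewrite (_ : _ @^-1` _ = `]a - u, b - u]%classic); last first.
  by apply/seteqP; split => x /=; rewrite !in_itv/= => /andP[ax xb]; apply/andP; lra.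
by rewrite !lebesgue_measure_itv/= !lte_fin ltrD2r; case: ifP => //; rewrite -!EFinB => _; congr EFin; ring.
Qed.

Lemma ge0_integral_addl u (f : R -> \bar R) : measurable_fun [set: R] f ->
  (forall x, (0 <= f x)%E) -> (\int[leb]_x f (u + x)%R = \int[leb]_x f x)%E.
Proof.
move=> mf f0.
have E := @ge0_integral_pushforward _ _ (measurableTypeR R) (measurableTypeR R) R _
  (measurable_addl u) leb setT f measurableT mf
  (fun x _ => f0 x).
rewrite preimage_setT in E.
rewrite -[LHS]E.
apply: eq_measure_integral; first exact: measurable_addl.
by move=> mu_ A mA _; exact: lebesgue_measure_addl.
Qed.

Lemma normal_pdf_gaussE m s x : s != 0 ->
  normal_pdf m s x = (Num.sqrt (s ^+ 2 * pi *+ 2))^-1 * expR (- (x - m) ^+ 2 / (s ^+ 2 *+ 2)).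
Proof. by move=> s0; rewrite normal_pdfE. Qed.

Lemma normal_pdf_addl u m s x : s != 0 -> normal_pdf (u + m) s (u + x) = normal_pdf m s x.
Proof. by move=> s0; rewrite !normal_pdf_gaussE//; do 4 f_equal; ring. Qed.

Lemma normal_prob_addl u m s B : s != 0 -> measurable B ->
  normal_prob m s [set x | B (u + x)] = normal_prob (u + m) s B.
Proof.
move=> s0 mB; rewrite /normal_prob [RHS]integral_mkcond -(@ge0_integral_addl u).
- rewrite [LHS]integral_mkcond; apply: eq_integral => x _.
  by rewrite /patch -(normal_pdf_addl u)//.
- have H := (measurable_restrictT (fun x => (normal_pdf (u + m) s x)%:E) mB).1.
  apply: H; apply/measurable_EFinP. apply/measurable_funTS. exact: measurable_normal_pdf.
- by move=> x; rewrite /patch; case: ifP => // _; rewrite lee_fin normal_pdf_ge0.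
Qed.

(** The density is a Radon-Nikodym derivative of the law with respect to the
    Lebesgue measure, because both have the same integral over every set. *)
Lemma ge0_integral_normal_prob m s (f : R -> \bar R) : s != 0 ->
  measurable_fun [set: R] f -> (forall x, (0 <= f x)%E) ->
  (\int[normal_prob m s]_x f x = \int[leb]_x (f x * (normal_pdf m s x)%:E))%E.
Proof.
move=> s0 mf f0.
have nmu := @normal_prob_dominates R m s.
rewrite -(@Radon_Nikodym_SigmaFinite.change_of_variables _ _ _ (normal_prob m s) leb nmu)//.
apply: ae_eq_integral => //.
- apply: emeasurable_funM => //; apply: (measurable_int leb).
  exact: Radon_Nikodym_SigmaFinite.f_integrable.
- apply: emeasurable_funM => //=; apply/measurable_EFinP.
  exact: measurable_normal_pdf.
- apply: ae_eqe_mul2l => /=; apply: integral_ae_eq => //=.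
  + exact: Radon_Nikodym_SigmaFinite.f_integrable.
  + by apply/measurable_EFinP; exact: measurable_normal_pdf.
  + by move=> E _ mE; rewrite -Radon_Nikodym_SigmaFinite.f_integral.
Qed.
End NormalIntegrals.

(** * Sums of independent normal variables *)

Section NormalConvolution.
Variable R : realType.
Implicit Types (m s u x y : R) (B : set R).
Local Notation leb := (@lebesgue_measure R).

(** Completing the square: the joint density of [u] and [y = u + v], with [u]
    and [v] independent normal, factors as the density of [y] times the
    conditional density of [u] given [y], both normal. *)
Lemma normal_pdf_mul m1 m2 s1 s2 u y : 0 < s1 -> 0 < s2 ->
  let s := Num.sqrt (s1 ^+ 2 + s2 ^+ 2) in
  normal_pdf m1 s1 u * normal_pdf (u + m2) s2 y =
  normal_pdf (m1 + m2) s y *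
  normal_pdf (m1 + s1 ^+ 2 * (y - m1 - m2) / s ^+ 2) (s1 * s2 / s) u.
Proof.
move=> s10 s20 s.
have q0 : 0 < s1 ^+ 2 + s2 ^+ 2 by rewrite addr_gt0// exprn_gt0.
have s0 : 0 < s by rewrite sqrtr_gt0.
have s2E : s ^+ 2 = s1 ^+ 2 + s2 ^+ 2 by rewrite sqr_sqrtr// ltW.
have r0 : 0 < s1 * s2 / s by rewrite divr_gt0// mulr_gt0.
rewrite !normal_pdf_gaussE ?gt_eqF// mulrACA [RHS]mulrACA -!expRD; congr (_ * _).
  rewrite -!invfM -!sqrtrM ?mulrn_wge0 ?mulr_ge0 ?sqr_ge0 ?pi_ge0 ?invr_ge0 ?(ltW s0) ?(ltW s10) ?(ltW s20)//.
  congr (Num.sqrt _)^-1; rewrite expr_div_n exprMn; field.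
  by rewrite gt_eqF.
congr expR; rewrite expr_div_n exprMn s2E; field.
by rewrite !gt_eqF.
Qed.

Lemma normal_prob_addlE m s u B : s != 0 -> measurable B ->
  (normal_prob m s [set x | B (u + x)%R] =
   \int[leb]_y (normal_pdf m s (y - u) * \1_B y)%:E)%E.
Proof.
move=> s0 mB; rewrite normal_prob_addl// /normal_prob integral_mkcond.
apply: eq_integral => y _; rewrite /patch indicE.
have -> : normal_pdf m s (y - u) = normal_pdf (u + m) s y.
  by rewrite -(normal_pdf_addl u)// [u + (y - u)]addrC subrK.
by case: ifP => _; rewrite ?mulr1 ?mulr0.
Qed.

Lemma measurable_normal_prob_addl m s B : s != 0 -> measurable B ->
  measurable_fun [set: R] (fun u => normal_prob m s [set x | B (u + x)]).
Proof.
move=> s0 mB; rewrite (_ : (fun u => _) =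
    (fun u => \int[leb]_y (normal_pdf m s (y - u) * \1_B y)%:E)%E); last first.
  by apply/funext => u; exact: normal_prob_addlE.
apply: (@measurable_fun_fubini_tonelli_F _ _ R (measurableTypeR R) R leb
  (fun z => (normal_pdf m s (z.2 - z.1) * \1_B z.2)%:E)) => /=.
  apply/measurable_EFinP; apply: measurable_funM.
    apply: measurableT_comp; first exact: measurable_normal_pdf.
    by apply: measurable_funB.
  by apply: measurableT_comp.
by move=> z; rewrite lee_fin mulr_ge0 ?normal_pdf_ge0.
Qed.

(** The left-hand side is the law of the sum of two independent normal
    variables. By [normal_pdf_mul] and Tonelli, the conditional density
    integrates to 1 and the density of the sum remains. *)
Lemma normal_prob_convolution m1 m2 s1 s2 B : 0 < s1 -> 0 < s2 ->
  measurable B ->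
  (\int[normal_prob m1 s1]_u normal_prob m2 s2 [set x | B (u + x)%R] =
  normal_prob (m1 + m2) (Num.sqrt (s1 ^+ 2 + s2 ^+ 2)) B)%E.
Proof.
move=> s10 s20 mB.
pose F (z : R * R) : \bar R :=
  ((normal_pdf m2 s2 (z.2 - z.1) * \1_B z.2)%:E * (normal_pdf m1 s1 z.1)%:E)%E.
have mF : measurable_fun [set: R * R] F.
  apply: emeasurable_funM; apply/measurable_EFinP.
    apply: measurable_funM.
      apply: measurableT_comp; first exact: measurable_normal_pdf.
      by apply: measurable_funB.
    apply: measurableT_comp => //.
  by apply: measurableT_comp; first exact: measurable_normal_pdf.
have F0 z : (0 <= F z)%E.
  by rewrite mule_ge0// lee_fin ?mulr_ge0 ?normal_pdf_ge0.
set s := Num.sqrt _.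
have q0 : 0 < s1 ^+ 2 + s2 ^+ 2 by rewrite addr_gt0// exprn_gt0.
have s0 : 0 < s by rewrite sqrtr_gt0.
have s20' : s2 != 0 by rewrite gt_eqF.
rewrite ge0_integral_normal_prob ?gt_eqF//; last exact: measurable_normal_prob_addl.
transitivity (\int[leb]_u \int[leb]_y F (u, y))%E.
  apply: eq_integral => u _; rewrite normal_prob_addlE// -ge0_integralZr//.
  - apply/measurable_EFinP; apply: measurable_funM => //.
    apply: measurableT_comp; first exact: measurable_normal_pdf.
    by apply: measurable_funB.
  - by move=> y _; rewrite lee_fin mulr_ge0 ?normal_pdf_ge0.
  - by rewrite lee_fin normal_pdf_ge0.
rewrite fubini_tonelli// /normal_prob [RHS]integral_mkcond.
apply: eq_integral => y _.
transitivity (\int[leb]_u ((normal_pdf (m1 + m2) s y * \1_B y)%:E *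
   (normal_pdf (m1 + s1 ^+ 2 * (y - m1 - m2) / s ^+ 2) (s1 * s2 / s) u)%:E))%E.
  apply: eq_integral => u _; rewrite /F/= -!EFinM; congr EFin.
  rewrite mulrAC [RHS]mulrAC -normal_pdf_mul//; congr (_ * _); rewrite mulrC; congr (_ * _).
  by rewrite -(normal_pdf_addl u) ?gt_eqF// [u + (y - u)]addrC subrK.
rewrite ge0_integralZl//.
- rewrite integral_normal_pdf mule1 /patch indicE.
  by case: ifP => _; rewrite ?mulr1 ?mulr0.
- by apply/measurable_EFinP; exact: measurable_normal_pdf.
- by move=> u _; rewrite lee_fin normal_pdf_ge0.
- by rewrite lee_fin mulr_ge0 ?normal_pdf_ge0.
Qed.
End NormalConvolution.

(** * Central moments of normal laws *)

Section NormalMoments.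
Variable R : realType.
Implicit Types (m s u x y : R) (k : nat).
Local Notation leb := (@lebesgue_measure R).

Lemma integral_exprn k x : 0 <= x ->
  (\int[leb]_(u in `[0%R, x]) (k.+1%:R * u ^+ k)%:E = (x ^+ k.+1)%:E)%E.
Proof.
rewrite le_eqVlt => /predU1P[<-|x0].
  by rewrite set_itv1 integral_set1 expr0n.
rewrite (@continuous_FTC2 R _ (fun u => u ^+ k.+1))//.
- by rewrite expr0n/= sube0.
- apply: continuous_subspaceT => u; apply: cvgM; [exact: cvg_cst|exact: exprn_continuous].
- split.
  + by move=> u _; exact: exprn_derivable.
  + apply: cvg_at_right_filter; exact: exprn_continuous.
  + apply: cvg_at_left_filter; exact: exprn_continuous.
- move=> u _. by rewrite derive1E exp_derive/= [LHS]mulr1.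
Qed.

Lemma is_derive_normal_pdf s x : s != 0 ->
  is_derive x 1 (normal_pdf 0 s) (- (x / s ^+ 2) * normal_pdf 0 s x).
Proof.
move=> s0.
have -> : normal_pdf 0 s = (fun x => (Num.sqrt (s ^+ 2 * pi *+ 2))^-1 *
   expR (- x ^+ 2 / (s ^+ 2 *+ 2))).
  by apply/funext => y; rewrite normal_pdf_gaussE// subr0.
have d1 : is_derive x 1 (fun x : R => - x ^+ 2 / (s ^+ 2 *+ 2)) (- (x / s ^+ 2)).
  have -> : (fun x : R => - x ^+ 2 / (s ^+ 2 *+ 2)) =
            (- (s ^+ 2 *+ 2)^-1) \*: (fun x : R => x ^+ 2).
    by apply/funext => y /=; rewrite /GRing.scale/= mulrC mulrN mulNr mulrC.
  apply: is_derive_eq; rewrite /GRing.scale/=; field; exact: s0.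
have d2 := @is_derive1_comp R expR _ x _ _ (is_derive_expR _) d1.
have d3 := @is_deriveZ R R _ _ (Num.sqrt (s ^+ 2 * pi *+ 2))^-1 x 1 _ d2.
apply: (is_derive_eq d3); rewrite /GRing.scale/=; ring.
Qed.

Lemma normal_pdf_cvgy s : s != 0 -> normal_pdf 0 s x @[x --> +oo] --> (0 : R).
Proof.
move=> s0.
have c0 : 0 < Num.sqrt (s ^+ 2 *+ 2).
  by rewrite sqrtr_gt0 pmulrn_lgt0// exprn_even_gt0.
rewrite (_ : normal_pdf 0 s = (fun x => (Num.sqrt (s ^+ 2 * pi *+ 2))^-1 *
   gauss_fun (x * (Num.sqrt (s ^+ 2 *+ 2))^-1))); last first.
  apply/funext => x; rewrite normal_pdf_gaussE// subr0 /gauss_fun; do 2 f_equal.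
  by rewrite exprMn exprVn sqr_sqrtr ?mulrn_wge0 ?sqr_ge0// mulNr.
rewrite -[X in _ --> X](mulr0 (Num.sqrt (s ^+ 2 * pi *+ 2))^-1).
apply: cvgM; first exact: cvg_cst.
apply: (cvg_comp _ _ _ (@cvg_gauss_fun R)).
by apply/gt0_cvgMly; rewrite ?invr_gt0//.
Qed.

(** [- s^2] times the density is an antiderivative of the integrand. *)
Lemma integral_mul_normal_pdf s u : s != 0 -> 0 <= u ->
  (\int[leb]_(x in `[u, +oo[) (x * normal_pdf 0 s x)%:E
   = (s ^+ 2 * normal_pdf 0 s u)%:E)%E.
Proof.
move=> s0 u0.
have cpdf : continuous (normal_pdf 0 s) by exact: continuous_normal_pdf.
rewrite (@ge0_continuous_FTC2y R _ (fun x => - s ^+ 2 * normal_pdf 0 s x) u 0).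
- by rewrite sub0e -EFinN; congr EFin; rewrite mulNr opprK.
- by move=> x ux; rewrite mulr_ge0 ?normal_pdf_ge0// (le_trans u0).
- by apply: continuous_subspaceT => x; apply: cvgM => //; exact: cpdf.
- rewrite -[X in _ --> X](mulr0 (- s ^+ 2)); apply: cvgM; first exact: cvg_cst.
  exact: normal_pdf_cvgy.
- move=> x _; apply: derivableM => //.
  by have [] := is_derive_normal_pdf x s0.
- apply: cvg_at_right_filter; apply: cvgM; [exact: cvg_cst|exact: cpdf].
- move=> x _; rewrite derive1E.
  have d := is_derive_normal_pdf x s0.
  have -> : (fun x : R => - s ^+ 2 * normal_pdf 0 s x) = (- s ^+ 2) \*: normal_pdf 0 s by [].
  rewrite deriveZ// derive_val /GRing.scale/=; field; exact: s0.
Qed.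

(** Integration by parts in the form of Tonelli's theorem: write [x^(k+1)] as
    the integral of [(k+1) u^k] over [0 <= u <= x] and integrate in [x] first,
    with [integral_mul_normal_pdf]. All integrands are nonnegative, so no
    integrability at infinity has to be established beforehand. *)
Lemma normal_moment_halfline k s : s != 0 ->
  (\int[leb]_(x in `[0%R, +oo[) (x ^+ k.+2 * normal_pdf 0 s x)%:E =
   (s ^+ 2 * k.+1%:R)%:E * \int[leb]_(x in `[0%R, +oo[) (x ^+ k * normal_pdf 0 s x)%:E)%E.
Proof.
move=> s0.
pose A := [set z : R * R | (0 <= z.1) && (z.1 <= z.2)].
pose F (z : R * R) : \bar R :=
  ((k.+1%:R * z.1 ^+ k) * (z.2 * normal_pdf 0 s z.2) * \1_A z)%:E.
have mA : measurable A.
  rewrite [A](_ : _ = (fun z : R * R => (0 <= z.1) && (z.1 <= z.2)) @^-1` [set true])//.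
  rewrite -[X in measurable X]setTI.
  by apply: measurable_and => //; apply: measurable_fun_ler.
have mpdf : measurable_fun [set: R] (normal_pdf 0 s) by exact: measurable_normal_pdf.
have mF : measurable_fun [set: R * R] F.
  apply/measurable_EFinP/measurable_funM; last exact: measurable_indic.
  apply: measurable_funM; first by apply: measurable_funM => //; exact: measurable_funX.
  by apply: measurable_funM => //; apply: measurableT_comp.
have F0 z : (0 <= F z)%E.
  rewrite lee_fin indicE; have [|_] := boolP (z \in A); last by rewrite mulr0.
  rewrite inE => /andP[z0 z1]; rewrite mulr1 !mulr_ge0 ?normal_pdf_ge0 ?exprn_ge0//.
  exact: le_trans z1.
transitivity (\int[leb]_x \int[leb]_u F (u, x))%E.
  rewrite integral_mkcond; apply: eq_integral => x _; rewrite /patch mem_setE in_itv/= andbT.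
  case: ifPn => x0; last first.
    rewrite integral0_eq// => u _; rewrite /F/= indicE memNset ?mulr0//= => /andP[u0 ux].
    by rewrite (le_trans u0 ux) in x0.
  transitivity ((x * normal_pdf 0 s x)%:E * \int[leb]_(u in `[0%R, x]) (k.+1%:R * u ^+ k)%:E)%E.
    by rewrite integral_exprn// -EFinM (exprS x k.+1); congr EFin; ring.
  rewrite -ge0_integralZl//.
  - rewrite integral_mkcond; apply: eq_integral => u _.
    rewrite /patch mem_setE in_itv/= /F/= indicE; case: ifPn => ux.
      by rewrite mem_set ?mulr1//= -EFinM mulrC.
    by rewrite memNset ?mulr0//= => ux'; rewrite ux' in ux.
  - apply/measurable_EFinP/measurable_funTS.
    by apply: measurable_funM => //; exact: measurable_funX.
  - by move=> u; rewrite /= in_itv/= => /andP[u0 _]; rewrite lee_fin mulr_ge0 ?exprn_ge0.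
  - by rewrite lee_fin mulr_ge0 ?normal_pdf_ge0.
rewrite -fubini_tonelli// [in RHS]integral_mkcond -ge0_integralZl//; last 3 first.
- apply/(measurable_restrictT _ _).1 => //; apply/measurable_EFinP/measurable_funTS.
  by apply: measurable_funM => //; exact: measurable_funX.
- move=> x _; rewrite /patch mem_setE in_itv/= andbT; case: ifP => // x0.
  by rewrite lee_fin mulr_ge0 ?normal_pdf_ge0 ?exprn_ge0.
- by rewrite lee_fin mulr_ge0 ?sqr_ge0.
apply: eq_integral => u _; rewrite /patch mem_setE in_itv/= andbT.
case: ifPn => u0; last first.
  rewrite integral0_eq ?mule0// => x _; rewrite /F/= indicE memNset ?mulr0//= => /andP[u1 ux].
  by rewrite u1 in u0.
transitivity ((k.+1%:R * u ^+ k)%:E * \int[leb]_(x in `[u, +oo[) (x * normal_pdf 0 s x)%:E)%E.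
  rewrite -ge0_integralZl//.
  - rewrite [RHS]integral_mkcond; apply: eq_integral => x _.
    rewrite /patch mem_setE in_itv/= andbT /F/= indicE; case: ifPn => ux.
      by rewrite mem_set ?mulr1//; apply/andP.
    by rewrite memNset ?mulr0//= => /andP[_ ux']; rewrite ux' in ux.
  - apply/measurable_EFinP/measurable_funTS.
    by apply: measurable_funM.
  - move=> x; rewrite /= in_itv/= andbT => ux.
    by rewrite lee_fin mulr_ge0 ?normal_pdf_ge0// (le_trans u0).
  - by rewrite lee_fin mulr_ge0 ?exprn_ge0.
by rewrite integral_mul_normal_pdf// -!EFinM; congr EFin; ring.
Qed.

Lemma normal_even_moment_step k s : s != 0 -> ~~ odd k ->
  (\int[leb]_x (x ^+ k.+2 * normal_pdf 0 s x)%:E =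
   (s ^+ 2 * k.+1%:R)%:E * \int[leb]_x (x ^+ k * normal_pdf 0 s x)%:E)%E.
Proof.
move=> s0 ek.
have sym j : ~~ odd j -> (\int[leb]_x (x ^+ j * normal_pdf 0 s x)%:E =
    2%:E * \int[leb]_(x in `[0%R, +oo[) (x ^+ j * normal_pdf 0 s x)%:E)%E.
  move=> ej; rewrite ge0_symfun_integralT -?set_itvcy//.
  - by move=> x; rewrite mulr_ge0 ?normal_pdf_ge0// exprn_even_ge0.
  - move=> x; apply: cvgM; first exact: exprn_continuous.
    exact: continuous_normal_pdf.
  - move=> x /=; rewrite exprNn -signr_odd (negbTE ej) expr0 mul1r.
    by rewrite !normal_pdf_gaussE// !subr0 sqrrN.
by rewrite !sym ?oddS ?negbK// normal_moment_halfline// muleCA.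
Qed.

Lemma normal_central_momentE m s k : s != 0 -> ~~ odd k ->
  (\int[normal_prob m s]_x ((x - m) ^+ k)%:E =
   \int[leb]_x (x ^+ k * normal_pdf 0 s x)%:E)%E.
Proof.
move=> s0 ek.
have mX : measurable_fun [set: R] (fun x => ((x - m) ^+ k)%:E).
  by apply/measurable_EFinP/measurable_funX; exact: measurable_funB.
have X0 x : (0 <= ((x - m) ^+ k)%:E)%E by rewrite lee_fin exprn_even_ge0.
rewrite ge0_integral_normal_prob// -(@ge0_integral_addl _ m).
- apply: eq_integral => x _; rewrite -EFinM; congr (_ * _)%:E; first by rewrite addrC addKr.
  by rewrite -{1}[m]addr0 normal_pdf_addl.
- by apply: emeasurable_funM => //; apply/measurable_EFinP; exact: measurable_normal_pdf.
- by move=> x; rewrite mule_ge0// lee_fin normal_pdf_ge0.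
Qed.

Lemma normal_central_moment2 m s : s != 0 ->
  (\int[normal_prob m s]_x ((x - m) ^+ 2)%:E = (s ^+ 2)%:E)%E.
Proof.
move=> s0; rewrite normal_central_momentE// normal_even_moment_step//.
under eq_integral do rewrite expr0 mul1r.
by rewrite integral_normal_pdf mule1 mulr1.
Qed.

Lemma normal_central_moment4 m s : s != 0 ->
  (\int[normal_prob m s]_x ((x - m) ^+ 4)%:E = (3 * (s ^+ 2) ^+ 2)%:E)%E.
Proof.
move=> s0; rewrite normal_central_momentE// normal_even_moment_step//.
rewrite -(normal_central_momentE 0)// normal_central_moment2// -EFinM.
by congr EFin; ring.
Qed.

End NormalMoments.

(** * The standard normal distribution function and its quantiles *)

Section StandardNormalCdf.
Variable R : realType.
Implicit Types (m s u x y : R).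
Local Notation leb := (@lebesgue_measure R).

Lemma PhiE x : ((Phi x)%:E = normal_prob 0 1 `]-oo, x])%E.
Proof. by rewrite /Phi fineK// fin_num_measure. Qed.

(** The density is even and the law has no atoms. *)
Lemma PhiN x : Phi (- x) = 1 - Phi x.
Proof.
apply: EFin_inj; rewrite EFinB !PhiE.
have c : continuous (normal_pdf (0 : R) 1) by apply: continuous_normal_pdf.
have -> : normal_prob 0 1 `]-oo, - x] = normal_prob (0 : R) 1 `[x, +oo[.
  rewrite /normal_prob ge0_integration_by_substitutionNy.
  - by apply: eq_integral => y _ /=; rewrite !normal_pdf_gaussE// !subr0 sqrrN.
  - exact: continuous_subspaceT.
  - by move=> y _; rewrite normal_pdf_ge0.
rewrite -[in RHS](@probability_setT _ _ R (normal_prob (0 : R) 1)).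
have -> : normal_prob 0 1 `]-oo, x] = normal_prob (0 : R) 1 `]-oo, x[.
  by rewrite /normal_prob integral_itv_bndo_bndc//; apply/measurable_EFinP/measurable_funTS; exact: measurable_normal_pdf.
rewrite -(setUv `]-oo, x[%classic) setCitvl measureU//.
- by rewrite addeAC subee ?add0e// fin_num_measure.
- by rewrite -setCitvl setICr.
Qed.

Lemma Phi_increment x y : x <= y ->
  ((Phi y - Phi x)%:E = \int[leb]_(t in `]x, y]) (normal_pdf 0 1 t)%:E)%E.
Proof.
move=> xy; rewrite EFinB !PhiE.
rewrite (_ : `]-oo, y]%classic = `]-oo, x] `|` `]x, y]); last first.
  rewrite -itv_bndbnd_setU//.
rewrite measureU//=.
- by rewrite addeAC subee ?add0e// fin_num_measure.
- apply/seteqP; split => // t /=; rewrite !in_itv/= => -[a /andP[b _]]; lra.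
Qed.

Lemma Phi_mono x y : x <= y -> Phi x <= Phi y.
Proof.
move=> xy; rewrite -subr_ge0 -lee_fin Phi_increment//.
by apply: integral_ge0 => t _; rewrite lee_fin normal_pdf_ge0.
Qed.

(** The standard normal density is bounded by [1 / sqrt (2 pi) <= 1]. *)
Lemma Phi_lipschitz x y : x <= y -> Phi y - Phi x <= y - x.
Proof.
move=> xy; rewrite -lee_fin Phi_increment//.
apply: (@le_trans _ _ (\int[leb]_(t in `]x, y]) (cst 1%E) t)%E).
  apply: ge0_le_integral => //.
  - by move=> t _; rewrite lee_fin normal_pdf_ge0.
  - by apply/measurable_EFinP/measurable_funTS; exact: measurable_normal_pdf.
  - move=> t _; rewrite lee_fin (le_trans (normal_pdf_ub _ _ _))//.
    rewrite /normal_peak invf_le1; last by rewrite sqrtr_gt0 expr1n mul1r mulrn_wgt0 ?pi_gt0.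
    rewrite -[leLHS]sqrtr1 ler_sqrt// expr1n mul1r; have := pi_ge2 R; rewrite mulr2n; lra.
rewrite integral_cst//= mul1e lebesgue_measure_itv/= lte_fin.
by case: ltP => //; rewrite ?lee_fin; lra.
Qed.

(** On [`]x, y]] the density is at least its value at the largest modulus. *)
Lemma Phi_strict x y : x < y -> Phi x < Phi y.
Proof.
move=> xy; rewrite -subr_gt0 -lte_fin Phi_increment ?ltW//.
pose M := Num.max `|x| `|y|.
pose c := normal_pdf 0 1 M.
have c0 : 0 < c.
  rewrite /c normal_pdf_gaussE// mulr_gt0 ?expR_gt0// invr_gt0 sqrtr_gt0 expr1n mul1r.
  by rewrite mulrn_wgt0 ?pi_gt0.
apply: (@lt_le_trans _ _ (\int[leb]_(t in `]x, y]) (cst c%:E) t)%E).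
  rewrite integral_cst//= lebesgue_measure_itv/= lte_fin xy -EFinB -EFinM lte_fin mulr_gt0// subr_gt0//.
apply: ge0_le_integral => //.
- by move=> t _; rewrite lee_fin ltW.
- by apply/measurable_EFinP/measurable_funTS; exact: measurable_normal_pdf.
move=> t; rewrite /= in_itv/= => /andP[xt ty]; rewrite lee_fin /c !normal_pdf_gaussE// !subr0.
rewrite ler_wpM2l ?invr_ge0 ?sqrtr_ge0// ler_expR ler_wpM2r ?invr_ge0 ?expr1n//.
rewrite lerN2 -[leLHS]real_normK ?num_real// lerXn2r ?nnegrE ?normr_ge0//.
  by rewrite le_max normr_ge0.
rewrite /M le_max; apply/orP; case: (leP 0 t) => t0; [right|left].
  by rewrite (ger0_norm t0); exact: le_trans ty (ler_norm _).
by rewrite (ltr0_norm t0) ltr0_norm; lra.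
Qed.

(** Chebyshev's inequality for the standard normal law. *)
Lemma Phi_tail x : 0 < x -> 1 - Phi x <= (x ^+ 2)^-1.
Proof.
move=> x0; rewrite -PhiN -lee_fin PhiE.
have x20 : 0 < x ^+ 2 by rewrite exprn_gt0.
rewrite -(@lee_pmul2l _ (x ^+ 2)%:E)// -EFinM mulfV ?gt_eqF//.
rewrite -integral_cst//.
apply: (@le_trans _ _ (\int[normal_prob (0 : R) 1]_(t in `]-oo, (- x)%R]) ((t - 0) ^+ 2)%:E)%E).
  apply: ge0_le_integral => //.
  - by move=> t _; rewrite /= lee_fin ltW.
  - by apply/measurable_EFinP/measurable_funX; exact: measurable_funB.
  - move=> t; rewrite /= in_itv/= lee_fin subr0 => tx.
    by rewrite -(sqrrN t) lerXn2r ?nnegrE; lra.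
rewrite [leRHS](_ : _ = \int[normal_prob (0 : R) 1]_t ((t - 0) ^+ 2)%:E)%E; last first.
  by rewrite normal_central_moment2// expr1n.
apply: ge0_subset_integral => //.
  by apply/measurable_EFinP/measurable_funX; exact: measurable_funB.
by move=> t _; rewrite lee_fin sqr_ge0.
Qed.

(** Since [Phi] is Lipschitz, its value at the infimum defining the quantile can
    be neither above nor below the level. *)
Lemma Phi_zquantile b : 0 < b < 1 -> Phi (zquantile b : R) = b.
Proof.
move=> /andP[b0 b1].
pose S : set R := [set x | b <= Phi x].
have tail c : 0 < c -> exists x, Phi (- x) < c.
  move=> c0; exists (c^-1 + 1).
  have ci : 0 < c^-1 by rewrite invr_gt0.
  rewrite PhiN; apply: le_lt_trans (Phi_tail _) _; first by lra.
  by rewrite invf_plt ?posrE ?exprn_gt0//; nra.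
have Phi_hi : exists x, b <= Phi x.
  have [x xb] := tail (1 - b) ltac:(lra); exists x.
  by move: xb; rewrite PhiN; lra.
have Phi_lo : exists x, Phi x < b by have [x xb] := tail b b0; exists (- x).
have hS : has_inf S.
  split; first by case: Phi_hi => x; exists x.
  case: Phi_lo => x xb; exists x => y; rewrite /S/= => yb.
  by rewrite leNgt; apply/negP => yx; have := Phi_mono (ltW yx); lra.
apply/eqP; rewrite eq_le; apply/andP; split; rewrite leNgt; apply/negP => h.
- set z := zquantile b in h.
  have zz : z - (Phi z - b) / 2 <= z by lra.
  have : S (z - (Phi z - b) / 2) by have := Phi_lipschitz zz; rewrite /S/=; lra.
  by move=> /(ge_inf hS.2); rewrite -/(zquantile b) -/z; lra.
- have e0 : 0 < (b - Phi (zquantile b)) / 2 by lra.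
  have [x xS xz] := inf_adherent e0 hS.
  have zx : zquantile b <= x by exact: ge_inf hS.2 _ xS.
  have := Phi_lipschitz zx; move: xS xz; rewrite /S/= -/(zquantile b); lra.
Qed.

Lemma Phi_inj : injective (@Phi R).
Proof.
move=> x y xy; apply/eqP; rewrite eq_le; apply/andP; split; rewrite leNgt;
  by apply/negP => /Phi_strict; rewrite xy ltxx.
Qed.

Lemma zquantileN b : 0 < b < 1 -> zquantile (1 - b) = - zquantile b :> R.
Proof.
move=> b01; apply: Phi_inj; rewrite PhiN !Phi_zquantile//; lra.
Qed.

(** Shift-invariance reduces the tail of [N(m, 1)] to that of [N(0, 1)]. *)
Lemma normal_prob_tail m t : normal_prob m 1 [set x | m + t < x] = (1 - Phi t)%:E.
Proof.
have -> : [set x | m + t < x] = ~` `]-oo, m + t].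
  by apply/seteqP; split => x /=; rewrite in_itv/= ltNge => /negP.
rewrite probability_setC// EFinB PhiE; congr (_ - _)%E.
have E : normal_prob 0 1 [set x | `]-oo, (m + t)%R]%classic (m + x)] =
         normal_prob m 1 `]-oo, (m + t)%R] by rewrite normal_prob_addl// addr0.
apply: etrans (esym E) _.
suff -> : [set x | `]-oo, (m + t)%R]%classic (m + x)] = `]-oo, t]%classic by [].
by apply/seteqP; split => x /=; rewrite !in_itv/= lerD2l.
Qed.

End StandardNormalCdf.

(** * Freezing one of two independent sigma-algebras *)

Section IndependentSigmaAlgebras.
Context {R : realType} {disp} {T : measurableType disp} (Pr : probability T R).
Local Open Scope ereal_scope.

(** Both sides are finite measures in [E] that agree on a pi-system
    containing the whole space. *)
Lemma indep_g_sigma_algebra_l (G : set (set T)) (F : set T) :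
  G `<=` measurable -> setI_closed G -> G setT -> measurable F ->
  (forall E, G E -> Pr (E `&` F) = Pr E * Pr F) ->
  forall E, <<s G >> E -> Pr (E `&` F) = Pr E * Pr F.
Proof.
move=> Gm GI GT mF GF E sE.
pose r : {nonneg R} := NngNum (fine_ge0 (measure_ge0 Pr F)).
have rE : r%:num%:E = Pr F by rewrite /r/= fineK// fin_num_measure.
have : mrestr Pr mF E = mscale r Pr E.
  apply: (@g_sigma_algebra_measure_unique _ R T G Gm (fun=> setT)) => //.
  - by rewrite bigcup_const.
  - by move=> A GA; rewrite /= /mscale /mrestr rE GF// muleC.
  - by move=> k; rewrite /= /mrestr (le_lt_trans (probability_le1 _ _))// ?ltry// setTI.
by rewrite /mrestr /mscale rE muleC.
Qed.

Variables G1 G2 : set (set T).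
Hypotheses (G1m : G1 `<=` measurable) (G2m : G2 `<=` measurable).
Hypotheses (G1I : setI_closed G1) (G2I : setI_closed G2).
Hypotheses (G1T : G1 setT) (G2T : G2 setT).
Hypothesis G12 : forall E F, G1 E -> G2 F -> Pr (E `&` F) = Pr E * Pr F.

Lemma g_sigma_algebra_measurable (G : set (set T)) : G `<=` measurable ->
  <<s G >> `<=` measurable.
Proof. by move=> Gm; apply: smallest_sub => //; exact: sigma_algebra_measurable. Qed.

Lemma indep_g_sigma_algebra E F : <<s G1 >> E -> <<s G2 >> F ->
  Pr (E `&` F) = Pr E * Pr F.
Proof.
move=> sE sF; apply: (indep_g_sigma_algebra_l G1m) => //.
  exact: (g_sigma_algebra_measurable G2m).
move=> E' GE'; rewrite setIC muleC; apply: (indep_g_sigma_algebra_l G2m) => //.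
  exact: G1m.
by move=> F' GF'; rewrite setIC muleC G12.
Qed.

Let S1 : measurableType _ := g_sigma_algebraType G1.
Let S2 : measurableType _ := g_sigma_algebraType G2.

Let id1 (x : T) : S1 := x.
Let id2 (x : T) : S2 := x.
Let diag (x : T) : S1 * S2 := (x, x).

Let mid1 : measurable_fun setT id1.
Proof. by move=> _ B mB; rewrite setTI; exact: (g_sigma_algebra_measurable G1m). Qed.

Let mid2 : measurable_fun setT id2.
Proof. by move=> _ B mB; rewrite setTI; exact: (g_sigma_algebra_measurable G2m). Qed.

Let mdiag : measurable_fun setT diag.
Proof. by apply: measurable_fun_pair; [exact: mid1|exact: mid2]. Qed.

Let id1M : {mfun T >-> S1} := HB.pack id1 (isMeasurableFun.Build _ _ _ _ _ mid1).
Let id2M : {mfun T >-> S2} := HB.pack id2 (isMeasurableFun.Build _ _ _ _ _ mid2).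
Let diagM : {mfun T >-> (S1 * S2)%type} :=
  HB.pack diag (isMeasurableFun.Build _ _ _ _ _ mdiag).

(** The law of the diagonal [x |-> (x, x)] on the product of the two
    sigma-algebras is the product measure, because the product rule holds on
    rectangles. Measuring a set of pairs can thus be done with two independent
    copies, one component at a time; [y] plays the role of the sample that stays
    random while [x] is frozen. *)
Lemma probability_freeze (E : set (S1 * S2)) : measurable E ->
  Pr [set x | E (x, x)] = \int[Pr]_x Pr [set y | E (x, y)].
Proof.
move=> mE.
have H := @product_measure_unique _ _ S1 S2 R (distribution Pr id1M) (distribution Pr id2M)
  (distribution Pr diagM).
apply: etrans (esym (H _ E mE)) _.
  by move=> A B mA mB; exact: (indep_g_sigma_algebra mA mB).
rewrite /product_measure1.
rewrite ge0_integral_distribution//=.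
- by apply: eq_integral => x _; rewrite /= /distribution/pushforward xsectionE.
- exact: measurable_fun_xsection.
Qed.

Lemma probability_freeze_le (E : set (S1 * S2)) (p : \bar R) : measurable E ->
  (forall x, Pr [set y | E (x, y)] <= p) -> Pr [set x | E (x, x)] <= p.
Proof.
move=> mE Ep; rewrite probability_freeze//.
have <- : \int[Pr]_x cst p x = p by rewrite integral_cst//= probability_setT mule1.
have p0 : 0 <= p by apply: le_trans (Ep point); exact: measure_ge0.
apply: ge0_le_integral => //.
have mP2 := measurable_fun_xsection (distribution Pr id2M) mE.
rewrite (_ : (fun x => _) = (distribution Pr id2M \o xsection E) \o id1).
  exact: measurableT_comp mP2 mid1.
by apply/funext => x; rewrite /= /distribution/pushforward xsectionE.
Qed.

End IndependentSigmaAlgebras.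

(** * Linear forms of an independent normal sample *)

Section LinearForms.
Context {R : realType} {disp} {T : measurableType disp} {d : nat}.
Implicit Types (a b x : d.-tuple R).

Lemma measurable_dotp (f g : T -> d.-tuple R) :
  measurable_fun setT f -> measurable_fun setT g ->
  measurable_fun setT (fun w => dotp (f w) (g w)).
Proof.
move=> mf mg; apply: measurable_sum => k; apply: measurable_funM.
- by apply: (measurableT_comp (measurable_tnth k)).
- by apply: (measurableT_comp (measurable_tnth k)).
Qed.

Lemma measurable_sum_seq (I : eqType) (r : seq I) (h : I -> T -> R) :
  (forall k, k \in r -> measurable_fun setT (h k)) ->
  measurable_fun setT (fun w => \sum_(k <- r) h k w).
Proof.
elim: r => [|k r IH] mh.
  have -> : (fun w => \sum_(k <- [::]) h k w) = cst 0.
    by apply/funext => w; rewrite big_nil.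
  exact: measurable_cst.
have -> : (fun w => \sum_(j <- k :: r) h j w) = h k \+ (fun w => \sum_(j <- r) h j w).
  by apply/funext => w; rewrite big_cons.
apply: measurable_funD; first by apply: mh; rewrite mem_head.
by apply: IH => j jr; apply: mh; rewrite inE jr orbT.
Qed.

End LinearForms.

Section Cylinders.
Context {R : realType} {disp} {T : measurableType disp} {Pr : probability T R}.
Context {n d : nat} (X : 'I_n -> {RV Pr >-> d.-tuple R}).
Context {P : probability (d.-tuple R) R}.
Hypothesis hX : iid_sample X P.
Implicit Types I J : pred 'I_n.

(** A pi-system generating the sigma-algebra of the observations with index in
    [I]. *)
Definition cylinders I : set (set T) := [set E | exists B : 'I_n -> set (d.-tuple R),
  [/\ forall i, measurable (B i), forall i, ~~ I i -> B i = setT &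
      E = \bigcap_(i in [set: 'I_n]) (X i @^-1` B i)]].

Lemma measurable_cylinder I : cylinders I `<=` measurable.
Proof.
move=> _ [B [mB _ ->]]; apply: fin_bigcap_measurable; first exact: finite_finset.
by move=> i _; rewrite -[X in measurable X]setTI; exact: measurable_funP.
Qed.

Lemma cylindersT I : cylinders I setT.
Proof. by exists (fun=> setT); split => //; apply/esym; rewrite bigcapT//. Qed.

Lemma setI_closed_cylinders I : setI_closed (cylinders I).
Proof.
move=> _ _ [B [mB IB ->]] [C [mC IC ->]]; exists (fun i => B i `&` C i); split.
- by move=> i; exact: measurableI.
- by move=> i iI; rewrite IB// IC// setIT.
- apply/seteqP; split => w /=.
    by move=> [Bw Cw] i _; split; [exact: Bw|exact: Cw].
  by move=> BCw; split => i iT; have [] := BCw i iT.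
Qed.

(** In the product rule each index contributes a constraint from at most one of
    the two cylinders. *)
Lemma cylinders_indep I J E F : (forall i, ~~ (I i && J i)) ->
  cylinders I E -> cylinders J F -> Pr (E `&` F) = (Pr E * Pr F)%E.
Proof.
move=> IJ [B [mB IB ->]] [C [mC IC ->]].
have -> : \bigcap_(i in [set: 'I_n]) (X i @^-1` B i) `&`
    \bigcap_(i in [set: 'I_n]) (X i @^-1` C i) =
    \bigcap_(i in [set: 'I_n]) (X i @^-1` (B i `&` C i)).
  apply/seteqP; split => w /=.
    by move=> [Bw Cw] i _; split; [exact: Bw|exact: Cw].
  by move=> BCw; split => i iT; have [] := BCw i iT.
rewrite !hX.2// => [|i]; last exact: measurableI.
rewrite -big_split/=; apply: eq_bigr => i _.
have := IJ i; have [Ii Ji|Ii _] := boolP (I i).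
  by rewrite (IC i)// setIT preimage_setT probability_setT mule1.
by rewrite (IB i)// setTI preimage_setT probability_setT mul1e.
Qed.

Lemma measurable_sample I i : I i ->
  measurable_fun [set: g_sigma_algebraType (cylinders I)] (X i).
Proof.
move=> Ii _ B mB; rewrite setTI; apply: sub_sigma_algebra.
exists (fun j => if j == i then B else setT); split.
- by move=> j; case: ifP.
- by move=> j jI; case: eqP jI => // ->; rewrite Ii.
- apply/seteqP; split => w /=.
    by move=> Bw j _; rewrite /preimage/=; case: eqP => // ->.
  by move/(_ i Logic.I); rewrite /preimage/= eqxx.
Qed.

Lemma sample_freeze_le I J
    (E : set (g_sigma_algebraType (cylinders I) * g_sigma_algebraType (cylinders J)))
    (p : \bar R) :
  (forall i, ~~ (I i && J i)) -> measurable E ->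
  (forall x, Pr [set y | E (x, y)] <= p)%E -> (Pr [set x | E (x, x)] <= p)%E.
Proof.
move=> IJ; apply: probability_freeze_le => //; try exact: measurable_cylinder;
  try exact: setI_closed_cylinders; try exact: cylindersT.
by move=> A B; exact: cylinders_indep.
Qed.

Variables (mu : d.-tuple R) (Sigma : 'M[R]_d).
Hypothesis hP : is_mvnormal P mu Sigma.

Lemma sample_dotp_normal (a : d.-tuple R) i (B : set R) : 0 < quadform Sigma a ->
  measurable B ->
  Pr [set w | B (dotp a (X i w))] = normal_prob (dotp a mu) (Num.sqrt (quadform Sigma a)) B.
Proof.
move=> a0 mB.
have mS : measurable [set x : d.-tuple R | B (dotp a x)].
  rewrite -[X in measurable X]setTI.
  apply: (@measurable_dotp _ _ _ _ (cst a) id) => //.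
have := hX.1 i _ mS; rewrite /distribution/pushforward => ->.
by have [_ _ ->//] := hP; rewrite /normal_law gt_eqF.
Qed.

(** Induction on the list of indices: by independence the first term can be
    frozen while the others are summed, and the induction step is then the
    convolution of two normal laws. Nonzero variances keep every law in the
    recursion absolutely continuous. *)
Lemma sample_linear_form_normal (a : 'I_n -> d.-tuple R) (r : seq 'I_n) (B : set R) :
  uniq r -> (0 < size r)%N -> (forall i, i \in r -> 0 < quadform Sigma (a i)) ->
  measurable B ->
  Pr [set w | B (\sum_(i <- r) dotp (a i) (X i w))] =
  normal_prob (\sum_(i <- r) dotp (a i) mu)
    (Num.sqrt (\sum_(i <- r) quadform Sigma (a i))) B.
Proof.
elim: r B => // i [|j r] IH B.
  move=> _ _ a0 mB; rewrite !big_seq1 -(sample_dotp_normal i)// ?a0 ?mem_head//.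
  by congr (Pr _); apply/seteqP; split => w /=; rewrite big_seq1.
move=> /andP[ir ur] _ a0 mB; set r' := j :: r in IH ir ur a0 *.
have r0 k : k \in r' -> 0 < quadform Sigma (a k).
  by move=> kr; rewrite a0// inE kr orbT.
have v0 : 0 < \sum_(k <- r') quadform Sigma (a k).
  by rewrite big_cons ltr_wpDr ?r0 ?mem_head// big_seq sumr_ge0// => k kr;
     rewrite ltW// r0// inE kr orbT.
have i0 : 0 < quadform Sigma (a i) by rewrite a0// mem_head.
pose G1 := cylinders (pred1 i); pose G2 := cylinders (mem r').
pose E : set (g_sigma_algebraType G1 * g_sigma_algebraType G2) :=
  [set z | B (dotp (a i) (X i z.1) + \sum_(k <- r') dotp (a k) (X k z.2))].
have mE : measurable E.
  rewrite -[X in measurable X]setTI.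
  have mf : measurable_fun [set: g_sigma_algebraType G1 * g_sigma_algebraType G2]
    (fun z => dotp (a i) (X i z.1) + \sum_(k <- r') dotp (a k) (X k z.2)).
    apply: measurable_funD.
      apply: measurable_dotp => //; apply: measurableT_comp; last exact: measurable_fst.
      by apply: measurable_sample; rewrite /= eqxx.
    apply: measurable_sum_seq => k kr.
    apply: measurable_dotp => //; apply: measurableT_comp; last exact: measurable_snd.
    by apply: measurable_sample.
  exact: mf.
transitivity (Pr [set w | E (w, w)]).
  by congr (Pr _); apply/seteqP; split => w /=; rewrite big_cons.
rewrite (@probability_freeze _ _ _ Pr G1 G2) //; first last.
- by move=> A C; apply: cylinders_indep => k; rewrite /=; case: eqP => // ->; rewrite (negbTE ir).
- exact: cylindersT.
- exact: cylindersT.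
- exact: setI_closed_cylinders.
- exact: setI_closed_cylinders.
- exact: measurable_cylinder.
- exact: measurable_cylinder.
pose li (w : T) : measurableTypeR R := dotp (a i) (X i w).
have mli : measurable_fun [set: T] li.
  by apply: measurable_dotp => //; exact: measurable_funP.
pose l : {mfun T >-> measurableTypeR R} := HB.pack li (isMeasurableFun.Build _ _ _ _ _ mli).
set m2 := \sum_(k <- r') dotp (a k) mu.
set s2 := Num.sqrt (\sum_(k <- r') quadform Sigma (a k)).
have s20 : 0 < s2 by rewrite sqrtr_gt0.
pose g (u : measurableTypeR R) : \bar R := normal_prob m2 s2 [set x | B ((u : R) + x)].
have mg : measurable_fun [set: measurableTypeR R] g.
  by apply: measurable_normal_prob_addl; rewrite ?gt_eqF.
have g0 u : (0 <= g u)%E by exact: measure_ge0.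
transitivity (\int[Pr]_w (g \o l) w)%E.
  apply: eq_integral => w _; rewrite /g/=.
  have mB' : measurable [set x | B (dotp (a i) (X i w) + x)].
    rewrite -[X in measurable X]setTI.
    exact: (measurable_addl (dotp (a i) (X i w))).
  have := IH _ ur isT r0 mB'; exact.
rewrite -(ge0_integral_distribution l mg g0).
transitivity (\int[normal_prob (dotp (a i) mu) (Num.sqrt (quadform Sigma (a i)))]_u g u)%E.
  by apply: eq_measure_integral => A mA _; exact: sample_dotp_normal.
have s10 : 0 < Num.sqrt (quadform Sigma (a i)) by rewrite sqrtr_gt0.
have e1 : \sum_(k <- i :: r') dotp (a k) mu = dotp (a i) mu + m2 by rewrite big_cons.
have e2 : \sum_(k <- i :: r') quadform Sigma (a k) =
    Num.sqrt (quadform Sigma (a i)) ^+ 2 + s2 ^+ 2.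
  by rewrite big_cons !sqr_sqrtr ?(ltW i0) ?(ltW v0).
rewrite e1 e2.
exact: (normal_prob_convolution (dotp (a i) mu) m2 s10 s20 mB).
Qed.

End Cylinders.

(** * Moments of products and quadratic forms *)

Section HasMean.
Context {R : realType} {disp} {T : measurableType disp} (Pr : probability T R).
Implicit Types (f g : T -> R) (a b c eta : R).

(** Integrability is part of the relation, so that it is closed under linear
    combinations without side conditions. *)
Definition has_mean f c : Prop :=
  Pr.-integrable setT (EFin \o f) /\ (\int[Pr]_w (f w)%:E = c%:E)%E.

Lemma has_mean_eq f g a b : f =1 g -> a = b -> has_mean f a -> has_mean g b.
Proof. by move=> /funext -> ->. Qed.

Lemma has_mean_cst c : has_mean (fun=> c) c.
Proof.
split; first exact: finite_measure_integrable_cst.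
by rewrite (integral_cst _ _ c%:E)//= probability_setT mule1.
Qed.

Lemma has_meanD f g a b : has_mean f a -> has_mean g b ->
  has_mean (fun w => f w + g w) (a + b).
Proof.
move=> [fi fE] [gi gE]; split; first exact: (integrableD measurableT fi gi).
by rewrite -[RHS]/(a%:E + b%:E)%E -fE -gE -integralD.
Qed.

Lemma has_meanZ c f a : has_mean f a -> has_mean (fun w => c * f w) (c * a).
Proof.
move=> [fi fE]; split; first exact: (integrableZl measurableT c fi).
by rewrite EFinM -fE -integralZl.
Qed.

Lemma has_mean_sum (I : Type) (r : seq I) (p : pred I) (F : I -> T -> R) (a : I -> R) :
  (forall i, has_mean (F i) (a i)) ->
  has_mean (fun w => \sum_(i <- r | p i) F i w) (\sum_(i <- r | p i) a i).
Proof.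
move=> Fa; elim: r => [|i r IH].
  by apply: has_mean_eq (has_mean_cst 0) => [w|]; rewrite big_nil.
have [pi|pi] := boolP (p i).
  by apply: has_mean_eq (has_meanD (Fa i) IH) => [w|]; rewrite big_cons pi.
by apply: has_mean_eq IH => [w|]; rewrite big_cons (negbTE pi).
Qed.

Lemma ge0_has_mean f c : measurable_fun setT f -> (forall w, 0 <= f w) ->
  (\int[Pr]_w (f w)%:E = c%:E)%E -> has_mean f c.
Proof.
move=> mf f0 fE; split=> //; apply/integrableP; split; first exact/measurable_EFinP.
under eq_integral do rewrite /= ger0_norm//.
by rewrite fE ltry.
Qed.

Lemma has_mean_chebyshev f V eta : measurable_fun setT f -> 0 < eta ->
  has_mean (fun w => f w ^+ 2) V ->
  (Pr [set w | (eta < `|f w|)%R] <= (V / eta ^+ 2)%:E)%E.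
Proof.
move=> mf eta0 [_ fE].
have e20 : 0 < eta ^+ 2 by rewrite exprn_gt0.
have mA : measurable [set w | eta < `|f w|].
  rewrite -[X in measurable X]setTI.
  have := measurable_fun_ltr (measurable_cst eta) (measurableT_comp (@normr_measurable R setT) mf).
  by move=> /(_ measurableT [set true] Logic.I); rewrite setTI.
rewrite -(@lee_pmul2l _ (eta ^+ 2)%:E)// -EFinM mulrCA divff ?gt_eqF// mulr1 -fE -integral_cst//.
apply: (@le_trans _ _ (\int[Pr]_(w in [set w | (eta < `|f w|)%R]) (f w ^+ 2)%:E)%E).
  apply: ge0_le_integral => //.
  - by move=> w _; rewrite /= lee_fin ltW.
  - by apply/measurable_EFinP/measurable_funTS/measurable_funX.
  - move=> w /= ew; rewrite lee_fin -(real_normK (num_real (f w))).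
    by rewrite lerXn2r ?nnegrE ?ltW// (lt_trans eta0).
apply: ge0_subset_integral => //.
  by apply/measurable_EFinP/measurable_funX.
by move=> w _; rewrite lee_fin sqr_ge0.
Qed.

End HasMean.

Section Wick.
Context {R : realType} {disp} {T : measurableType disp} (Pr : probability T R).
Variables (U : zmodType) (l : U -> T -> R) (B : U -> U -> R).
Hypotheses (lD : forall u v w, l (u + v) w = l u w + l v w)
  (lN : forall u w, l (- u) w = - l u w)
  (BC : forall u v, B u v = B v u)
  (BD : forall u v x, B (u + v) x = B u x + B v x)
  (BN : forall u x, B (- u) x = - B u x).
Hypothesis l2 : forall u, has_mean Pr (fun w => l u w ^+ 2) (B u u).
Hypothesis l4 : forall u, has_mean Pr (fun w => l u w ^+ 4) (3 * (B u u) ^+ 2).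

Let BDr u v x : B x (u + v) = B x u + B x v.
Proof. by rewrite BC BD !(BC x). Qed.
Let BNr u x : B x (- u) = - B x u.
Proof. by rewrite BC BN !(BC x). Qed.

(** Polarization of [l2]: [4 a b = (a + b)^2 - (a - b)^2]. *)
Lemma wick2 u v : has_mean Pr (fun w => l u w * l v w) (B u v).
Proof.
have h := has_meanD (has_meanZ 4^-1 (l2 (u + v))) (has_meanZ (- 4^-1) (l2 (u - v))).
apply: has_mean_eq h => [w|].
  by rewrite !lD !lN; field.
by rewrite !(BD, BDr, BN, BNr) (BC v u); field.
Qed.

(** Isserlis' formula, by polarization of [l4]: the sum over signs
    [e2, e3, e4 = 1, -1] of [e2 e3 e4 (a + e2 b + e3 c + e4 d)^4] is
    [192 a b c d], since only the monomial odd in [b], [c] and [d] survives. *)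
Lemma wick4 u v x y :
  has_mean Pr (fun w => l u w * l v w * (l x w * l y w))
    (B u v * B x y + B u x * B v y + B u y * B v x).
Proof.
have P z := has_meanZ 192^-1 (l4 z).
have N z := has_meanZ (- 192^-1) (l4 z).
(* The sign of each term is the product of the signs of [v], [x] and [y]. *)
have h := has_meanD
  (has_meanD (has_meanD (P (u + v + x + y)) (N (u - v + x + y)))
             (has_meanD (N (u + v - x + y)) (N (u + v + x - y))))
  (has_meanD (has_meanD (P (u - v - x + y)) (P (u - v + x - y)))
             (has_meanD (P (u + v - x - y)) (N (u - v - x - y)))).
apply: has_mean_eq h => [w|].
  by rewrite !lD !lN; field.
by rewrite !(BD, BDr, BN, BNr) (BC v u) (BC x u) (BC y u) (BC x v) (BC y v) (BC y x); field.
Qed.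

Variables (I : finType) (C : I -> I -> R) (u : I -> U).

(** The first of the three pairings in [wick4] reproduces the square of the
    mean, and cancels; the other two form the variance. *)
Lemma wick_quadratic_variance :
  has_mean Pr (fun w => (\sum_s \sum_t C s t * (l (u s) w * l (u t) w) -
                         \sum_s \sum_t C s t * B (u s) (u t)) ^+ 2)
    (\sum_s \sum_t \sum_s' \sum_t' C s t * C s' t' *
      (B (u s) (u s') * B (u t) (u t') + B (u s) (u t') * B (u t) (u s'))).
Proof.
set m := \sum_s \sum_t C s t * B (u s) (u t).
pose q w := \sum_s \sum_t C s t * (l (u s) w * l (u t) w).
have hq : has_mean Pr q m.
  by do 2 (apply: has_mean_sum => ? ); apply: has_meanZ; exact: wick2.
have hq2 : has_mean Pr (fun w => \sum_s \sum_t \sum_s' \sum_t' C s t * C s' t' *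
     (l (u s) w * l (u t) w * (l (u s') w * l (u t') w)))
   (\sum_s \sum_t \sum_s' \sum_t' C s t * C s' t' *
     (B (u s) (u t) * B (u s') (u t') + B (u s) (u s') * B (u t) (u t') +
      B (u s) (u t') * B (u t) (u s'))).
  by do 4 (apply: has_mean_sum => ? ); apply: has_meanZ; exact: wick4.
have prodE (F : I -> I -> R) :
  \sum_s \sum_t \sum_s' \sum_t' (C s t * C s' t' * (F s t * F s' t')) =
  (\sum_s \sum_t C s t * F s t) ^+ 2.
  rewrite expr2 mulr_suml; apply: eq_bigr => s _.
  rewrite mulr_suml; apply: eq_bigr => t _.
  rewrite mulr_sumr; apply: eq_bigr => s' _.
  by rewrite mulr_sumr; apply: eq_bigr => t' _; rewrite mulrACA.
have h := has_meanD (has_meanD hq2 (has_meanZ (- 2 * m) hq)) (has_mean_cst Pr (m ^+ 2)).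
apply: has_mean_eq h => [w|].
  rewrite (prodE (fun s t => l (u s) w * l (u t) w)) -/(q w); ring.
set V := RHS.
suff -> : \sum_s \sum_t \sum_s' \sum_t' C s t * C s' t' *
     (B (u s) (u t) * B (u s') (u t') + B (u s) (u s') * B (u t) (u t') +
      B (u s) (u t') * B (u t) (u s')) = m ^+ 2 + V by ring.
rewrite -(prodE (fun s t => B (u s) (u t))) /V -big_split; apply: eq_bigr => s _.
rewrite -big_split; apply: eq_bigr => t _; rewrite -big_split; apply: eq_bigr => s' _.
by rewrite -big_split; apply: eq_bigr => t' _ /=; ring.
Qed.

End Wick.

(** * Rayleigh quotients *)

Section QuadraticForms.
Variables (R : realType) (d : nat).
Implicit Types (S : 'M[R]_d) (x y : 'rV[R]_d) (a b c t : R).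

Definition bform S x y : R := \sum_k \sum_l x 0 k * S k l * y 0 l.

Lemma bformE S x y : bform S x y = (x *m S *m y^T) 0 0.
Proof.
rewrite mxE /bform exchange_big; apply: eq_bigr => l _; rewrite !mxE mulr_suml.
by apply: eq_bigr => k _.
Qed.

Lemma bformDl S x x' y : bform S (x + x') y = bform S x y + bform S x' y.
Proof. by rewrite !bformE !mulmxDl mxE. Qed.

Lemma bformZl S a x y : bform S (a *: x) y = a * bform S x y.
Proof. by rewrite !bformE -!scalemxAl mxE. Qed.

Lemma bformC S x y : S^T = S -> bform S x y = bform S y x.
Proof.
move=> tS; rewrite !bformE.
have -> : x *m S *m y^T = (y *m S *m x^T)^T by rewrite !trmx_mul trmxK tS mulmxA.
by rewrite mxE.
Qed.

Lemma bform1_ge0 x : 0 <= bform 1%:M x x.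
Proof.
rewrite bformE mulmx1 mxE; apply: sumr_ge0 => k _; rewrite mxE -expr2; exact: sqr_ge0.
Qed.

Lemma bform1_eq0 x : bform 1%:M x x = 0 -> x = 0.
Proof.
rewrite bformE mulmx1 mxE => /eqP; rewrite psumr_eq0 => [/allP h|k _]; last first.
  by rewrite mxE -expr2 sqr_ge0.
apply/rowP => k; apply/eqP; have := h k (mem_index_enum k).
by rewrite !mxE -expr2 sqrf_eq0.
Qed.

(** The case [c < 0] is excluded by [t = 1 - a / c], for which
    [a + c t^2 <= c < 0], taken with both signs to remove the linear term. *)
Lemma ge0_quadratic_discr a b c : (forall t, 0 <= a + 2 * b * t + c * t ^+ 2) ->
  b ^+ 2 <= a * c.
Proof.
move=> h; have a0 : 0 <= a by have := h 0; rewrite mulr0 expr0n/= mulr0 !addr0.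
have [c0|c0] := eqVneq c 0.
  rewrite c0 mulr0; have [->|b0] := eqVneq b 0; first by rewrite expr0n.
  have := h (- (a + 1) / (2 * b)); rewrite c0 mul0r addr0.
  have -> : a + 2 * b * (- (a + 1) / (2 * b)) = - 1 by field.
  by rewrite oppr_ge0 ler10.
have cp : 0 < c.
  rewrite lt_def c0/= leNgt; apply/negP => cn.
  pose t := 1 - a / c.
  have ct : c * t = c - a by rewrite /t; field.
  have t1 : 1 <= t by rewrite lerDl oppr_ge0 mulr_ge0_le0// invr_le0 ltW.
  have ctt : c * t ^+ 2 <= c - a.
    have : (c - a) * (t - 1) <= 0 by rewrite mulr_le0_ge0//; lra.
    by rewrite expr2 mulrA ct; lra.
  have h1 := h t; have h2 := h (- t); rewrite sqrrN in h2; lra.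
have := h (- b / c).
have -> : a + 2 * b * (- b / c) + c * (- b / c) ^+ 2 = (a * c - b ^+ 2) / c by field.
by rewrite pmulr_lge0 ?invr_gt0// subr_ge0.
Qed.

Lemma bform_CS S x y : S^T = S -> (forall z, 0 <= bform S z z) ->
  bform S x y ^+ 2 <= bform S x x * bform S y y.
Proof.
move=> tS S0; apply: ge0_quadratic_discr => t.
suff -> : bform S x x + 2 * bform S x y * t + bform S y y * t ^+ 2 =
  bform S (x + t *: y) (x + t *: y) by [].
rewrite bformDl bformZl !(bformC _ (x + _))// !bformDl !bformZl (bformC y x)//; ring.
Qed.

Lemma continuous_bform S : continuous (fun x => bform S x x).
Proof.
apply: continuous_big => [|k _]; first exact: add_continuous.
apply: continuous_big => [|l _]; first exact: add_continuous.
have c1 j : continuous (fun y : 'rV[R]_d => y 0 j) by exact: coord_continuous.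
by move=> x; exact: (cvgM (cvgM (c1 k x) (cvg_cst (S k l))) (c1 l x)).
Qed.

(** Let [m] be the maximum of the quadratic form on the unit sphere, attained
    at [c]. Then [m - S] is positive semidefinite and vanishes at [c], so [c] is
    in its kernel by Cauchy-Schwarz: [m] is an eigenvalue of [S]. *)
Lemma bform_le_eigenvalue S a : S^T = S -> (forall b, eigenvalue S b -> b <= a) ->
  forall x, bform S x x <= a * bform 1%:M x x.
Proof.
move=> tS Sa x; have [->|x0] := eqVneq x 0.
  by rewrite -(scale0r (0 : 'rV_d)) !bformZl !mul0r mulr0.
pose A : set 'rV[R]_d := [set y | bform 1%:M y y = 1].
have normalize y : y != 0 -> exists2 r, 0 < r & A (r *: y).
  move=> y0; have n0 : 0 < bform 1%:M y y.
    by rewrite lt_def bform1_ge0 andbT; apply: contraNneq y0 => /bform1_eq0 ->.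
  exists (Num.sqrt (bform 1%:M y y))^-1; first by rewrite invr_gt0 sqrtr_gt0.
  rewrite /A/= bformZl bformC ?tr_scalar_mx// bformZl mulrA -invfM -expr2 sqr_sqrtr ?ltW//.
  by rewrite mulVf// gt_eqF.
have cB : compact [set v : 'rV[R]_d | forall i, v ord0 i \in `[(-1)%R, 1%R]].
  apply: (@rV_compact _ _ (fun=> `[(-1 : R)%R, 1%R]%classic)).
  by move=> _; exact: segment_compact.
have cA : compact A.
  apply: subclosed_compact cB _.
  - rewrite (_ : A = (fun y => bform 1%:M y y) @^-1` [set 1])//.
    by apply: preimage_closed; [move=> y _; exact: continuous_bform|exact: closed_eq].
  - move=> y Ay k /=; rewrite in_itv/= -ler_norml.
    have : (y 0 k) ^+ 2 <= 1.
      rewrite -Ay bformE mulmx1 mxE (bigD1 k)//= mxE -expr2 lerDl.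
      by apply: sumr_ge0 => j _; rewrite mxE -expr2 sqr_ge0.
    by rewrite -real_normK ?num_real// expr_le1.
have A0 : A !=set0 by have [r _ Ar] := normalize x x0; exists (r *: x).
have [c cA' cmax] := compact_EVT_max A0 cA (continuous_subspaceT (@continuous_bform S)).
rewrite inE in cA'; set m := bform S c c in cmax.
have Sm y : bform S y y <= m * bform 1%:M y y.
  have [->|y0] := eqVneq y 0; first by rewrite -(scale0r (0 : 'rV_d)) !bformZl !mul0r mulr0.
  have [r r0 Ar] := normalize y y0.
  have := cmax (r *: y) (mem_set Ar); rewrite bformZl bformC// bformZl.
  move: Ar; rewrite /A/= bformZl bformC ?tr_scalar_mx// bformZl !mulrA -expr2 => Ar Hr.
  have r20 : 0 < r ^+ 2 by rewrite exprn_gt0.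
  by rewrite -(ler_pM2l r20) mulrCA Ar mulr1.
pose M := m%:M - S.
have tM : M^T = M by rewrite /M linearB/= tr_scalar_mx tS.
have ME y z : bform M y z = m * bform 1%:M y z - bform S y z.
  rewrite /M !bformE mulmxBr mulmxBl mul_mx_scalar mulmx1 -scalemxAl.
  by rewrite mxE [in X in _ + X]mxE mxE.
have M0 y : 0 <= bform M y y by rewrite ME subr_ge0.
have Mc y : bform M c y = 0.
  apply/eqP; rewrite -sqrf_eq0 eq_le sqr_ge0 andbT.
  apply: le_trans (bform_CS c y tM M0) _.
  by rewrite ME cA' mulr1 subrr mul0r.
have eig : c *m S = m *: c.
  apply/eqP; rewrite eq_sym -subr_eq0; apply/eqP.
  have -> : m *: c - c *m S = c *m M by rewrite /M mulmxBr mul_mx_scalar.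
  apply: bform1_eq0; have := Mc (c *m M); rewrite !bformE mulmx1; exact.
have c0 : c != 0.
  apply/eqP => c0; move: cA'; rewrite /A/= c0 -(scale0r (0 : 'rV_d)) bformZl mul0r => /eqP.
  by rewrite eq_sym oner_eq0.
have ma : m <= a by apply: Sa; apply/eigenvalueP; exists c.
by apply: le_trans (Sm x) _; rewrite ler_wpM2r ?bform1_ge0.
Qed.

Lemma bform_ge_eigenvalue S a : S^T = S -> (forall b, eigenvalue S b -> a <= b) ->
  forall x, a * bform 1%:M x x <= bform S x x.
Proof.
move=> tS Sa x.
have NE : bform (- S) x x = - bform S x x.
  by rewrite !bformE mulmxN mulNmx mxE.
rewrite -lerN2 -mulNr -NE; apply: bform_le_eigenvalue; first by rewrite linearN/= tS.
move=> b /eigenvalueP[v vb v0]; rewrite lerNr; apply: Sa; apply/eigenvalueP; exists v => //.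
by rewrite scaleNr -vb mulmxN opprK.
Qed.

End QuadraticForms.

(** * Consequences of the eigenvalue bounds *)

Section SpectralBounds.
Variables (R : realType) (d : nat) (S : 'M[R]_d) (lo hi : R).
Hypotheses (tS : S^T = S) (lo0 : 0 < lo) (hi0 : 0 < hi).
Hypothesis hS : forall a, eigenvalue S a -> lo <= a <= hi.

Let bform_hi x : bform S x x <= hi * bform 1%:M x x.
Proof. by apply: bform_le_eigenvalue => // b /hS/andP[]. Qed.

Let bform_lo x : lo * bform 1%:M x x <= bform S x x.
Proof. by apply: bform_ge_eigenvalue => // b /hS/andP[]. Qed.

Let bform_ge0 x : 0 <= bform S x x.
Proof. by apply: le_trans (bform_lo x); rewrite mulr_ge0 ?bform1_ge0 ?(ltW lo0). Qed.

(** Cauchy-Schwarz for the form [S] itself, applied to [x] and [x S]. *)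
Lemma bform1_mulmx_le (x : 'rV[R]_d) :
  bform 1%:M (x *m S) (x *m S) <= hi ^+ 2 * bform 1%:M x x.
Proof.
set N := bform 1%:M (x *m S) (x *m S).
have N0 : 0 <= N by exact: bform1_ge0.
have NE : bform S x (x *m S) = N by rewrite /N !bformE mulmx1.
have : N ^+ 2 <= (hi * bform 1%:M x x) * (hi * N).
  rewrite -NE; apply: le_trans (bform_CS _ _ tS bform_ge0) _.
  by rewrite ler_pM// ?bform_ge0// NE.
have [->|Nn0] := eqVneq N 0; first by rewrite mulr_ge0 ?sqr_ge0 ?bform1_ge0.
have Np : 0 < N by rewrite lt_def Nn0.
rewrite [X in _ <= X](_ : _ = (hi ^+ 2 * bform 1%:M x x) * N); last by ring.
by rewrite expr2 ler_pM2r.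
Qed.

Definition row_of_tuple (a : d.-tuple R) : 'rV[R]_d := \row_k tnth a k.

Lemma quadformE (M : 'M[R]_d) a : quadform M a = bform M (row_of_tuple a) (row_of_tuple a).
Proof.
by apply: eq_bigr => k _; apply: eq_bigr => l _; rewrite !mxE.
Qed.

Lemma dotpE (a b : d.-tuple R) : dotp a b = bform 1%:M (row_of_tuple a) (row_of_tuple b).
Proof.
by rewrite bformE mulmx1 mxE; apply: eq_bigr => k _; rewrite !mxE.
Qed.

Lemma quadform_hi a : quadform S a <= hi * dotp a a.
Proof. by rewrite quadformE dotpE. Qed.

Lemma quadform_eq0 a : quadform S a = 0 -> forall k, tnth a k = 0.
Proof.
move=> a0 k; have := bform_lo (row_of_tuple a); rewrite -(quadformE S) a0.
rewrite pmulr_rle0// => h; have /bform1_eq0/rowP/(_ k) : bform 1%:M (row_of_tuple a) (row_of_tuple a) = 0.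
  by apply/eqP; rewrite eq_le h bform1_ge0.
by rewrite !mxE.
Qed.

Definition mulmx_tuple (a : d.-tuple R) : d.-tuple R := [tuple \sum_l tnth a l * S l k | k < d].

Lemma row_mulmx_tuple a : row_of_tuple (mulmx_tuple a) = row_of_tuple a *m S.
Proof.
by apply/rowP => k; rewrite !mxE tnth_mktuple; apply: eq_bigr => l _; rewrite mxE.
Qed.

Lemma quadform_mulmx_le a : quadform S (mulmx_tuple a) <= hi ^+ 3 * dotp a a.
Proof.
rewrite quadformE row_mulmx_tuple; apply: le_trans (bform_hi _) _.
by rewrite exprS -mulrA ler_pM2l// dotpE; exact: bform1_mulmx_le.
Qed.

Let bform1_delta k : bform 1%:M (delta_mx 0 k : 'rV[R]_d) (delta_mx 0 k) = 1.
Proof.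
by rewrite bformE mulmx1 trmx_delta mul_delta_mx mxE !eqxx.
Qed.

(** The left-hand side is [tr (S^4)], the sum of the squared norms of the rows
    of [S^2]. *)
Lemma sum_sqr_mulmx_le : \sum_s \sum_t ((S *m S) s t) ^+ 2 <= hi ^+ 4 * d%:R.
Proof.
apply: le_trans (_ : \sum_(s < d) hi ^+ 4 <= _); last first.
  by rewrite sumr_const card_ord mulr_natr.
apply: ler_sum => s _.
have -> : \sum_t ((S *m S) s t) ^+ 2 =
   bform 1%:M ((delta_mx 0 s *m S) *m S) ((delta_mx 0 s : 'rV[R]_d) *m S *m S).
  rewrite -mulmxA -rowE bformE mulmx1 mxE; apply: eq_bigr => t _.
  by rewrite !mxE expr2.
apply: le_trans (bform1_mulmx_le _) _.
rewrite (exprD _ 2 2) ler_pM2l ?exprn_gt0//.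
by apply: le_trans (bform1_mulmx_le _) _; rewrite bform1_delta mulr1.
Qed.

(** Already the diagonal entries of [S], which are Rayleigh quotients at the
    basis vectors, contribute [lo^2] each. *)
Lemma trace_sqr_ge : lo ^+ 2 * d%:R <= \tr (S *m S).
Proof.
apply: le_trans (_ : \sum_(s < d) lo ^+ 2 <= _).
  by rewrite sumr_const card_ord mulr_natr.
apply: ler_sum => s _; rewrite mxE (bigD1 s)//=.
have Sss : lo <= S s s.
  have := bform_lo (delta_mx 0 s); rewrite bform1_delta mulr1 bformE -rowE.
  by rewrite trmx_delta -colE !mxE.
rewrite ler_wpDr//.
  by apply: sumr_ge0 => t _; rewrite -{2}tS mxE -expr2 sqr_ge0.
by rewrite -expr2 lerXn2r ?nnegrE ?(le_trans (ltW lo0) Sss) ?(ltW lo0).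
Qed.

End SpectralBounds.

(** * Centered linear forms of the sample *)

Section GaussianForms.
Context {R : realType} {disp} {T : measurableType disp} {Pr : probability T R}.
Context {n d : nat} (X : 'I_n -> {RV Pr >-> d.-tuple R}).
Context {P : probability (d.-tuple R) R}.
Variables (mu : d.-tuple R) (S : 'M[R]_d).
Hypothesis hX : iid_sample X P.
Hypothesis hP : is_mvnormal P mu S.
Hypothesis S0 : forall a : d.-tuple R, quadform S a = 0 -> forall k, tnth a k = 0.
Implicit Types A : 'M[R]_(n, d).

(** Linear forms of the whole sample are indexed by their matrix of coefficients,
    so that they make up a group, as polarization requires. *)
Definition centered_form A (w : T) : R :=
  \sum_i \sum_k A i k * (tnth (X i w) k - tnth mu k).

(** [tr (A S A'^T)], the covariance of the forms with coefficients [A] and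
    [A']. *)
Definition covariance_form A A' : R :=
  \sum_i \sum_k \sum_l A i k * S k l * A' i l.

Let rowt A i : d.-tuple R := [tuple A i k | k < d].

Lemma covariance_formC A A' : covariance_form A A' = covariance_form A' A.
Proof.
have [tS _ _] := hP.
apply: eq_bigr => i _; rewrite exchange_big; apply: eq_bigr => l _.
apply: eq_bigr => k _; rewrite -[in S k l]tS mxE; ring.
Qed.

Lemma covariance_formDl A A' A'' :
  covariance_form (A + A') A'' = covariance_form A A'' + covariance_form A' A''.
Proof.
rewrite -big_split; apply: eq_bigr => i _; rewrite -big_split; apply: eq_bigr => k _.
by rewrite -big_split; apply: eq_bigr => l _; rewrite mxE !mulrDl.
Qed.

Lemma covariance_formNl A A' : covariance_form (- A) A' = - covariance_form A A'.
Proof.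
rewrite -sumrN; apply: eq_bigr => i _; rewrite -sumrN; apply: eq_bigr => k _.
by rewrite -sumrN; apply: eq_bigr => l _; rewrite mxE !mulNr.
Qed.

Lemma centered_formD A A' w :
  centered_form (A + A') w = centered_form A w + centered_form A' w.
Proof.
rewrite -big_split; apply: eq_bigr => i _; rewrite -big_split; apply: eq_bigr => k _.
by rewrite mxE !mulrDl.
Qed.

Lemma centered_formN A w : centered_form (- A) w = - centered_form A w.
Proof.
rewrite -sumrN; apply: eq_bigr => i _; rewrite -sumrN; apply: eq_bigr => k _.
by rewrite mxE !mulNr.
Qed.

Lemma measurable_centered_form A : measurable_fun setT (centered_form A).
Proof.
apply: measurable_sum => i; apply: measurable_sum => k.
apply: measurable_funM => //; apply: measurable_funB => //.
by apply: (measurableT_comp (measurable_tnth k)).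
Qed.

Lemma covariance_form_ge0 A : 0 <= covariance_form A A.
Proof.
have [_ q0 _] := hP; apply: sumr_ge0 => i _; have := q0 (rowt A i).
by rewrite /quadform; under eq_bigr do under eq_bigr do rewrite !tnth_mktuple.
Qed.

(** Observations whose coefficient vector has zero variance have zero
    coefficients; the others form a sum of independent normal variables. *)
Lemma centered_form_law A (B : set R) : covariance_form A A != 0 -> measurable B ->
  Pr [set w | B (centered_form A w)] = normal_prob 0 (Num.sqrt (covariance_form A A)) B.
Proof.
move=> A0 mB; pose a := rowt A.
have aE i x : dotp (a i) x = \sum_k A i k * tnth x k.
  by apply: eq_bigr => k _; rewrite tnth_mktuple.
have qE i : quadform S (a i) = \sum_k \sum_l A i k * S k l * A i l.
  by apply: eq_bigr => k _; apply: eq_bigr => l _; rewrite !tnth_mktuple.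
pose r := [seq i <- index_enum 'I_n | quadform S (a i) != 0].
have notr i : quadform S (a i) = 0 -> forall x, dotp (a i) x = 0.
  move=> /S0 a0 x; rewrite /dotp big1// => k _; by rewrite a0 mul0r.
have sumr (F : 'I_n -> R) : (forall i, quadform S (a i) = 0 -> F i = 0) ->
    \sum_i F i = \sum_(i <- r) F i.
  move=> F0; rewrite big_filter [RHS]big_mkcond; apply: eq_bigr => i _.
  by case: eqVneq => // /F0.
have BE : covariance_form A A = \sum_(i <- r) quadform S (a i).
  by rewrite -sumr//; apply: eq_bigr => i _; rewrite qE.
have [_ q0 _] := hP.
have r0 i : i \in r -> 0 < quadform S (a i).
  by rewrite mem_filter => /andP[qi _]; rewrite lt_def qi q0.
have rs : (0 < size r)%N.
  by case: r BE {sumr r0} => // BE; move: A0; rewrite BE big_nil eqxx.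
have ur : uniq r by rewrite filter_uniq// index_enum_uniq.
set m := \sum_(i <- r) dotp (a i) mu.
have E w : \sum_(i <- r) dotp (a i) (X i w) = m + centered_form A w.
  rewrite /m -!sumr; last 2 first.
  - by move=> i /notr ->.
  - by move=> i /notr ->.
  rewrite /centered_form -big_split; apply: eq_bigr => i _ /=.
  by rewrite !aE -big_split; apply: eq_bigr => k _ /=; ring.
pose B' := [set y | B (- m + y)].
have mB' : measurable B'.
  by rewrite -[X in measurable X]setTI; exact: (measurable_addl (- m)).
have s0 : Num.sqrt (covariance_form A A) != 0.
  by rewrite gt_eqF// sqrtr_gt0 lt_def A0 covariance_form_ge0.
have := sample_linear_form_normal hX hP ur rs r0 mB'; rewrite -BE -/m.
have -> : [set w | B' (\sum_(i <- r) dotp (a i) (X i w))] = [set w | B (centered_form A w)].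
  by apply/seteqP; split => w /=; rewrite /B'/= E addrA addNr add0r.
move=> ->; have := @normal_prob_addl R m 0 _ B' s0 mB'.
have -> : [set y | B' (m + y)] = B.
  by apply/seteqP; split => y /=; rewrite /B'/= addrA addNr add0r.
by rewrite addr0.
Qed.

(** When the variance is zero the form vanishes identically, and the law is not
    given by a density. *)
Let centered_form_moment A k c :
  (forall s, s != 0 ->
     (\int[normal_prob 0 s]_x ((x - 0) ^+ k)%:E = (c (s ^+ 2))%:E)%E) ->
  (0 < k)%N -> ~~ odd k -> c 0 = 0 ->
  has_mean Pr (fun w => centered_form A w ^+ k) (c (covariance_form A A)).
Proof.
move=> hc k0 ek c0; have [A0|A0] := eqVneq (covariance_form A A) 0.
  rewrite A0 c0; apply: has_mean_eq (has_mean_cst Pr 0) => // w.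
  suff -> : centered_form A w = 0 by rewrite expr0n gtn_eqF.
  have q i : quadform S (rowt A i) = 0.
    have [_ q0 _] := hP.
    have qE i' : quadform S (rowt A i') = \sum_k \sum_l A i' k * S k l * A i' l.
      by apply: eq_bigr => k' _; apply: eq_bigr => l _; rewrite !tnth_mktuple.
    apply/eqP; move/eqP: A0; rewrite /covariance_form.
    under eq_bigr do rewrite -qE.
    rewrite psumr_eq0 => [/allP/(_ i (mem_index_enum i))//|i' _]; exact: q0.
  rewrite /centered_form big1// => i _; rewrite big1// => l _.
  by have := S0 (q i) l; rewrite tnth_mktuple => ->; rewrite mul0r.
pose v := covariance_form A A; have v0 : 0 < v by rewrite lt_def A0 covariance_form_ge0.
pose f (w : T) : measurableTypeR R := centered_form A w.
have mf : measurable_fun setT f by exact: measurable_centered_form.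
pose fM : {mfun T >-> measurableTypeR R} := HB.pack f (isMeasurableFun.Build _ _ _ _ _ mf).
apply: ge0_has_mean.
- by apply: measurable_funX; exact: measurable_centered_form.
- by move=> w; rewrite exprn_even_ge0.
pose g (x : measurableTypeR R) : \bar R := (((x : R) - 0) ^+ k)%:E.
have mg : measurable_fun [set: measurableTypeR R] g.
  by apply/measurable_EFinP/measurable_funX; exact: measurable_funB.
have g0 x : (0 <= g x)%E by rewrite lee_fin exprn_even_ge0.
transitivity (\int[Pr]_w (g \o fM) w)%E.
  by apply: eq_integral => w _; rewrite /g/= /f subr0.
rewrite -(ge0_integral_distribution fM mg g0).
transitivity (\int[normal_prob 0 (Num.sqrt v)]_x g x)%E.
  by apply: eq_measure_integral => B mB _; exact: centered_form_law.
by rewrite hc ?sqr_sqrtr ?gt_eqF ?sqrtr_gt0// ltW.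
Qed.

Lemma centered_form_moment2 A :
  has_mean Pr (fun w => centered_form A w ^+ 2) (covariance_form A A).
Proof.
by apply: (@centered_form_moment A 2 id) => //; exact: normal_central_moment2.
Qed.

Lemma centered_form_moment4 A :
  has_mean Pr (fun w => centered_form A w ^+ 4) (3 * (covariance_form A A) ^+ 2).
Proof.
apply: (@centered_form_moment A 4 (fun v => 3 * v ^+ 2)) => //.
  exact: normal_central_moment4.
by rewrite expr0n/= mulr0.
Qed.

Lemma centered_quadratic_variance (I : finType) (C : I -> I -> R) (u : I -> 'M[R]_(n, d)) :
  has_mean Pr (fun w =>
      (\sum_s \sum_t C s t * (centered_form (u s) w * centered_form (u t) w) -
       \sum_s \sum_t C s t * covariance_form (u s) (u t)) ^+ 2)
    (\sum_s \sum_t \sum_s' \sum_t' C s t * C s' t' *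
      (covariance_form (u s) (u s') * covariance_form (u t) (u t') +
       covariance_form (u s) (u t') * covariance_form (u t) (u s'))).
Proof.
exact: (wick_quadratic_variance centered_formD centered_formN covariance_formC
  covariance_formDl covariance_formNl centered_form_moment2 centered_form_moment4).
Qed.

End GaussianForms.

(** * Decomposition of the test statistic *)

Section MeanTestStatistic.
Variables (R : realType) (n d m1 : nat) (mu : d.-tuple R) (S : 'M[R]_d).
Hypothesis m1n : (0 < m1 < n)%N.
Implicit Types (x : 'I_n -> d.-tuple R) (v : d.-tuple R).

Local Notation m2 := (n - m1)%N.

Let m1_neq0 : m1%:R != 0 :> R.
Proof. by rewrite pnatr_eq0; case: m1 m1n. Qed.

Let m2_neq0 : m2%:R != 0 :> R.
Proof. by rewrite pnatr_eq0 subn_eq0 -ltnNge; case/andP: m1n. Qed.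

Lemma sum_first_sample (c : R) : \sum_(i < n | (i < m1)%N) c = m1%:R * c.
Proof.
have m1n' : (m1 <= n)%N by case/andP: m1n => _ /ltnW.
by rewrite (big_ord_narrow m1n') sumr_const card_ord mulr_natl.
Qed.

Lemma sum_second_sample (c : R) : \sum_(i < n | (m1 <= i)%N) c = m2%:R * c.
Proof.
have m1n' : (m1 <= n)%N by case/andP: m1n => _ /ltnW.
have := @bigID _ _ +%R _ (index_enum 'I_n) (fun i : 'I_n => (i < m1)%N) predT (fun=> c).
rewrite sumr_const card_ord/= sum_first_sample => E.
under eq_bigl do rewrite leqNgt.
by rewrite natrB// mulrBl [n%:R * c]mulr_natl E addrAC subrr add0r.
Qed.

Definition second_sample_mean x : d.-tuple R :=
  [tuple m2%:R^-1 * \sum_(j < n | (m1 <= j)%N) tnth (x j) k | k < d].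

Lemma f_meanE x y : f_mean m1 x y = dotp (second_sample_mean x) y.
Proof.
rewrite /f_mean /dotp exchange_big/= mulr_sumr; apply: eq_bigr => k _.
by rewrite tnth_mktuple -mulrA mulr_suml.
Qed.

Definition noise v x (i : 'I_n) : R := \sum_k tnth v k * (tnth (x i) k - tnth mu k).

Lemma dotp_noise v x i : dotp v (x i) = dotp v mu + noise v x i.
Proof. by rewrite -big_split; apply: eq_bigr => k _ /=; ring. Qed.

Definition stdev v : R := Num.sqrt (quadform S v).

(** The centered values of the frozen linear form [v], summed over the first
    sample and scaled to unit variance. *)
Definition standardized_mean v x : R :=
  (\sum_(i < n | (i < m1)%N) noise v x i) / (Num.sqrt m1%:R * stdev v).

(** The empirical variance of the same values scaled to unit variance. *)
Definition standardized_variance v x : R :=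
  m1%:R^-1 * \sum_(i < n | (i < m1)%N) (noise v x i / stdev v -
     m1%:R^-1 * \sum_(j < n | (j < m1)%N) noise v x j / stdev v) ^+ 2.

Lemma T_meanE x : 0 < quadform S (second_sample_mean x) ->
  T_mean m1 x = (Num.sqrt m1%:R * dotp (second_sample_mean x) mu / stdev (second_sample_mean x)
     + standardized_mean (second_sample_mean x) x) /
    Num.sqrt (standardized_variance (second_sample_mean x) x).
Proof.
set v := second_sample_mean x => q0.
have s0 : 0 < stdev v by rewrite sqrtr_gt0.
have s_neq0 : stdev v != 0 by rewrite gt_eqF.
have m0 : 0 < Num.sqrt m1%:R :> R by rewrite sqrtr_gt0 ltr0n; case/andP: m1n.
have mm : Num.sqrt m1%:R * Num.sqrt m1%:R = m1%:R :> R by rewrite -expr2 sqr_sqrtr.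
pose nb := m1%:R^-1 * \sum_(i < n | (i < m1)%N) noise v x i.
have fbarE : fbar_mean m1 x = dotp v mu + nb.
  rewrite /fbar_mean; under eq_bigr do rewrite f_meanE -/v dotp_noise.
  by rewrite big_split/= sum_first_sample mulrDr mulKf.
have varE : m1%:R^-1 * \sum_(i < n | (i < m1)%N) (f_mean m1 x (x i) - fbar_mean m1 x) ^+ 2
    = stdev v ^+ 2 * standardized_variance v x.
  have zb : m1%:R^-1 * \sum_(j < n | (j < m1)%N) noise v x j / stdev v = nb / stdev v.
    by rewrite -mulr_suml mulrA.
  rewrite /standardized_variance mulrCA; congr (_ * _); rewrite mulr_sumr zb.
  apply: eq_bigr => i _; rewrite f_meanE -/v dotp_noise fbarE.
  by field.
rewrite /T_mean varE sqrtrM ?sqr_ge0// sqrtr_sqr ger0_norm ?ltW// fbarE.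
rewrite /standardized_mean -/v [X in _ * X]invfM mulrA; congr (_ / _).
rewrite (_ : \sum_(i < n | (i < m1)%N) noise v x i = m1%:R * nb); last by rewrite /nb mulVKf.
set r := Num.sqrt _ in m0 mm *; rewrite -mm; field.
by rewrite s_neq0 gt_eqF.
Qed.

(** Coefficients of the form [<b, W - mu>], with [W] the mean of the second
    sample. *)
Definition second_sample_coef (b : 'rV[R]_d) : 'M[R]_(n, d) :=
  \matrix_(i, k) (if (m1 <= i)%N then m2%:R^-1 * b 0 k else 0).

Lemma second_sample_covariance b b' :
  covariance_form S (second_sample_coef b) (second_sample_coef b') = m2%:R^-1 * bform S b b'.
Proof.
transitivity (\sum_(i < n | (m1 <= i)%N) m2%:R^-1 ^+ 2 * bform S b b').
  rewrite [RHS]big_mkcond; apply: eq_bigr => i _; case: ifPn => im.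
    rewrite /bform mulr_sumr; apply: eq_bigr => k _; rewrite mulr_sumr; apply: eq_bigr => l _.
    by rewrite !mxE im; ring.
  by rewrite big1// => k _; rewrite big1// => l _; rewrite !mxE (negbTE im) mulr0.
by rewrite sum_second_sample expr2 -mulrA mulVKf.
Qed.

(** Coefficients of [a] times the sum over the first sample of the centered
    values of [v]. *)
Definition first_sample_coef (a : R) v : 'M[R]_(n, d) :=
  \matrix_(i, k) (if (i < m1)%N then a * tnth v k else 0).

Lemma first_sample_covariance a v :
  covariance_form S (first_sample_coef a v) (first_sample_coef a v) =
  m1%:R * (a ^+ 2 * quadform S v).
Proof.
rewrite -sum_first_sample [RHS]big_mkcond; apply: eq_bigr => i _; case: ifPn => im.
  rewrite /quadform mulr_sumr; apply: eq_bigr => k _; rewrite mulr_sumr; apply: eq_bigr => l _.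
  by rewrite !mxE im; ring.
by rewrite big1// => k _; rewrite big1// => l _; rewrite !mxE (negbTE im) mulr0.
Qed.

(** Coefficients of [a] times the centered value of [v] at the observation
    [s]. *)
Definition observation_coef (a : R) v (s : 'I_n) : 'M[R]_(n, d) :=
  \matrix_(i, k) (if i == s then a * tnth v k else 0).

Lemma observation_covariance a v s t :
  covariance_form S (observation_coef a v s) (observation_coef a v t) =
  if s == t then a ^+ 2 * quadform S v else 0.
Proof.
rewrite /covariance_form (bigD1 s)//= [X in _ + X]big1 ?addr0 => [|i /negbTE is_]; last first.
  by rewrite big1// => k _; rewrite big1// => l _; rewrite mxE is_ !mul0r.
case: eqVneq => st.
  rewrite /quadform mulr_sumr; apply: eq_bigr => k _; rewrite mulr_sumr; apply: eq_bigr => l _.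
  by rewrite !mxE st eqxx; ring.
by rewrite big1// => k _; rewrite big1// => l _; rewrite !mxE (negbTE st) mulr0.
Qed.

(** The matrix [(I - J / m1) / m1] of the empirical variance as a quadratic form,
    where [J] is the all-ones matrix, extended by 0 outside the first sample. *)
Definition sample_variance_coef (s t : 'I_n) : R :=
  if (s < m1)%N && (t < m1)%N then (if s == t then m1%:R^-1 else 0) - m1%:R^-1 ^+ 2 else 0.

Lemma sample_variance_coefE (z : 'I_n -> R) :
  m1%:R^-1 * \sum_(i < n | (i < m1)%N)
    (z i - m1%:R^-1 * \sum_(j < n | (j < m1)%N) z j) ^+ 2 =
  \sum_s \sum_t sample_variance_coef s t * (z s * z t).
Proof.
pose s1 := \sum_(j < n | (j < m1)%N) z j.
transitivity (m1%:R^-1 * (\sum_(i < n | (i < m1)%N) z i ^+ 2) - m1%:R^-1 ^+ 2 * s1 ^+ 2).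
  rewrite -/s1 (eq_bigr (fun i => z i ^+ 2 + (- 2 * m1%:R^-1 * s1 * z i +
    (m1%:R^-1 * s1) ^+ 2))); last by move=> i _; ring.
  rewrite !big_split/= -mulr_sumr -/s1 sum_first_sample; field; exact: m1_neq0.
transitivity (\sum_(s < n | (s < m1)%N) \sum_(t < n | (t < m1)%N)
   ((if s == t then m1%:R^-1 else 0) - m1%:R^-1 ^+ 2) * (z s * z t)).
  have -> : s1 ^+ 2 = \sum_(s < n | (s < m1)%N) \sum_(t < n | (t < m1)%N) z s * z t.
    by rewrite expr2 mulr_suml; apply: eq_bigr => s _; rewrite mulr_sumr.
  rewrite mulr_sumr mulr_sumr -sumrB; apply: eq_bigr => s sm.
  rewrite mulr_sumr [RHS](eq_bigr (fun t => (if s == t then m1%:R^-1 * (z s * z t) else 0)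
     + - (m1%:R^-1 ^+ 2 * (z s * z t)))); last first.
    by move=> t _; case: ifP => _; rewrite mulrBl ?mul0r.
  rewrite big_split/= sumrN; congr (_ - _).
  by rewrite (bigD1 s)//= eqxx big1 ?addr0 ?expr2// => t /andP[_]; rewrite eq_sym => /negbTE -> //.
rewrite big_mkcond; apply: eq_bigr => s _; case: ifPn => sm.
  rewrite big_mkcond; apply: eq_bigr => t _; rewrite /sample_variance_coef sm/=.
  by case: ifP => //; rewrite mul0r.
by rewrite big1// => t _; rewrite /sample_variance_coef (negbTE sm) mul0r.
Qed.

Lemma sum_sample_variance_coef_diag :
  \sum_s sample_variance_coef s s = 1 - m1%:R^-1.
Proof.
transitivity (\sum_(s < n | (s < m1)%N) (m1%:R^-1 - m1%:R^-1 ^+ 2 : R)).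
  rewrite [RHS]big_mkcond; apply: eq_bigr => s _.
  by rewrite /sample_variance_coef andbb eqxx.
by rewrite sum_first_sample; field.
Qed.

(** The sum equals [1 / m1 - 1 / m1^2]; it is half of the variance of the
    empirical variance of [m1] standard normal variables. *)
Lemma sum_sample_variance_coef_sqr :
  \sum_s \sum_t sample_variance_coef s t ^+ 2 <= m1%:R^-1.
Proof.
have m1p : 0 < m1%:R :> R by rewrite ltr0n; case/andP: m1n.
have -> : \sum_s \sum_t sample_variance_coef s t ^+ 2 =
    \sum_(s < n | (s < m1)%N) (m1%:R^-1 ^+ 2 - m1%:R^-1 ^+ 3 : R).
  rewrite [RHS]big_mkcond; apply: eq_bigr => s _; case: ifPn => sm; last first.
    by rewrite big1// => t _; rewrite /sample_variance_coef (negbTE sm) expr0n.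
  transitivity (\sum_(t < n | (t < m1)%N)
     ((if s == t then m1%:R^-1 ^+ 2 - 2 * m1%:R^-1 ^+ 3 else 0) + m1%:R^-1 ^+ 4 : R)).
    rewrite [RHS]big_mkcond; apply: eq_bigr => t _; rewrite /sample_variance_coef sm/=.
    by case: ifP => // _; [case: ifP => _; ring|rewrite expr0n].
  rewrite big_split/= sum_first_sample (bigD1 s)//= eqxx big1 ?addr0; last first.
    by move=> t /andP[_]; rewrite eq_sym => /negbTE ->.
  by field.
rewrite sum_first_sample.
have -> : m1%:R * (m1%:R^-1 ^+ 2 - m1%:R^-1 ^+ 3) = m1%:R^-1 - m1%:R^-1 ^+ 2 :> R by field.
by rewrite lerBlDr lerDl sqr_ge0.
Qed.

End MeanTestStatistic.

(** * Measurability of the statistics *)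

Section MeasurabilityOfStatistics.
Context {R : realType} {disp} {T : measurableType disp} {n d : nat}.
Variables (m1 : nat) (mu : d.-tuple R) (S : 'M[R]_d).
Implicit Types (f : T -> d.-tuple R) (g : T -> 'I_n -> d.-tuple R).

Lemma measurable_sum_cond (I : eqType) (r : seq I) (p : pred I) (h : I -> T -> R) :
  (forall i, p i -> measurable_fun setT (h i)) ->
  measurable_fun setT (fun w => \sum_(i <- r | p i) h i w).
Proof.
move=> mh; under eq_fun do rewrite -big_filter.
by apply: measurable_sum_seq => i; rewrite mem_filter => /andP[/mh].
Qed.

(** Inversion is continuous off the origin, and a singleton is measurable. *)
Lemma measurable_inv : measurable_fun [set: R] (@GRing.inv R).
Proof.
have -> : [set: R] = [set 0] `|` [set~ 0] by rewrite setUv.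
apply/measurable_funU => //; first exact: measurableC.
split; first exact: measurable_fun_set1.
apply: open_continuous_measurable_fun; first by apply: closed_openC; exact: closed_eq.
by move=> x; rewrite inE/= => x0; apply: inv_continuous; apply/eqP.
Qed.

Lemma measurable_sqrt : measurable_fun [set: R] (@Num.sqrt R).
Proof. by apply: continuous_measurable_fun; exact: sqrt_continuous. Qed.

Lemma measurable_fun_tnth f k : measurable_fun setT f -> measurable_fun setT (fun w => tnth (f w) k).
Proof. by move=> mf; apply: (measurableT_comp (measurable_tnth k)). Qed.

Lemma measurable_quadform f : measurable_fun setT f ->
  measurable_fun setT (fun w => quadform S (f w)).
Proof.
move=> mf; apply: measurable_sum => k; apply: measurable_sum => l.
by apply: measurable_funM; [apply: measurable_funM|] => //; exact: measurable_fun_tnth.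
Qed.

Lemma measurable_stdev f : measurable_fun setT f -> measurable_fun setT (fun w => stdev S (f w)).
Proof. by move=> mf; apply: measurableT_comp measurable_sqrt (measurable_quadform mf). Qed.

Lemma measurable_noise f g i : measurable_fun setT f -> measurable_fun setT (fun w => g w i) ->
  measurable_fun setT (fun w => noise mu (f w) (g w) i).
Proof.
move=> mf mg; apply: measurable_sum => k; apply: measurable_funM.
  exact: measurable_fun_tnth.
by apply: measurable_funB => //; exact: measurable_fun_tnth.
Qed.

Lemma measurable_second_sample_mean g :
  (forall i : 'I_n, (m1 <= i)%N -> measurable_fun setT (fun w => g w i)) ->
  measurable_fun setT (fun w => second_sample_mean m1 (g w)).
Proof.
move=> mg; apply/measurable_fun_tnthP => k.
rewrite (_ : _ \o _ = fun w => (n - m1)%:R^-1 * \sum_(j < n | (m1 <= j)%N) tnth (g w j) k).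
  apply: measurable_funM => //; apply: measurable_sum_cond => i im.
  by apply: measurable_fun_tnth; exact: mg.
by apply/funext => w; rewrite /= tnth_mktuple.
Qed.

Lemma measurable_standardized_mean f g : measurable_fun setT f ->
  (forall i : 'I_n, (i < m1)%N -> measurable_fun setT (fun w => g w i)) ->
  measurable_fun setT (fun w => standardized_mean m1 mu S (f w) (g w)).
Proof.
move=> mf mg; apply: measurable_funM.
  by apply: measurable_sum_cond => i im; apply: measurable_noise => //; exact: mg.
apply: measurableT_comp measurable_inv _.
by apply: measurable_funM => //; exact: measurable_stdev.
Qed.

Lemma measurable_standardized_variance f g : measurable_fun setT f ->
  (forall i : 'I_n, (i < m1)%N -> measurable_fun setT (fun w => g w i)) ->
  measurable_fun setT (fun w => standardized_variance m1 mu S (f w) (g w)).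
Proof.
move=> mf mg.
have mz (i : 'I_n) : (i < m1)%N -> measurable_fun setT (fun w => noise mu (f w) (g w) i / stdev S (f w)).
  move=> im; apply: measurable_funM; first by apply: measurable_noise => //; exact: mg.
  by apply: measurableT_comp measurable_inv _; exact: measurable_stdev.
apply: measurable_funM => //; apply: measurable_sum_cond => i im.
apply: measurable_funX; apply: measurable_funB; first exact: mz.
by apply: measurable_funM => //; apply: measurable_sum_cond => j jm; exact: mz.
Qed.

Lemma measurable_T_mean g : (forall i, measurable_fun setT (fun w => g w i)) ->
  measurable_fun setT (fun w => T_mean m1 (g w)).
Proof.
move=> mg.
have mdot i j : measurable_fun setT (fun w => dotp (g w i) (g w j)) by exact: measurable_dotp.
have mf i : measurable_fun setT (fun w => f_mean m1 (g w) (g w i)).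
  by apply: measurable_funM => //; apply: measurable_sum_cond.
have mfbar : measurable_fun setT (fun w => fbar_mean m1 (g w)).
  by apply: measurable_funM => //; apply: measurable_sum_cond.
apply: measurable_funM; first exact: measurable_funM.
apply: measurableT_comp measurable_inv _; apply: measurableT_comp measurable_sqrt _.
apply: measurable_funM => //; apply: measurable_sum_cond => i _.
by apply: measurable_funX; exact: measurable_funB.
Qed.

Lemma measurable_lt_set (f1 f2 : T -> R) : measurable_fun setT f1 -> measurable_fun setT f2 ->
  measurable [set w | f1 w < f2 w].
Proof.
move=> m1_ m2_; rewrite -[X in measurable X]setTI.
by have /(_ measurableT [set true] Logic.I) := measurable_fun_ltr m1_ m2_.
Qed.

End MeasurabilityOfStatistics.

(** * Perturbation of a studentized statistic *)

Section StudentizedComparison.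
Variable R : realType.
Implicit Types (p ps q c N z M k eta : R).

Lemma normr_sqrt_sub k a b : 0 < k -> k <= Num.sqrt a -> 0 <= b -> 0 <= a ->
  `|Num.sqrt a - Num.sqrt b| <= `|a - b| / k.
Proof.
move=> k0 ka b0 a0; rewrite ler_pdivlMr//.
rewrite -{2}(sqr_sqrtr a0) -{2}(sqr_sqrtr b0) subr_sqr normrM ler_wpM2l//.
by apply: le_trans ka _; apply: le_trans (ler_norm _); rewrite lerDl sqrtr_ge0.
Qed.

(** The lower bound [k] keeps the denominators away from 0; the factor 3
    accounts for the three terms of the variance around its limit. *)
Lemma ratio_sqrt_perturbation k M eta p ps q c : 0 < k -> 0 <= eta ->
  k <= Num.sqrt q -> k <= Num.sqrt c -> `|ps| <= M -> `|p - ps| <= eta -> `|q - c| <= 3 * eta ->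
  0 <= q -> 0 <= c ->
  `|p / Num.sqrt q - ps / Num.sqrt c| <= eta / k + 3 * M * eta / k ^+ 3.
Proof.
move=> k0 eta0 kq kc psM pps qc q0 c0.
have sq0 : 0 < Num.sqrt q by exact: lt_le_trans kq.
have sc0 : 0 < Num.sqrt c by exact: lt_le_trans kc.
have M0 : 0 <= M by apply: le_trans psM.
have -> : p / Num.sqrt q - ps / Num.sqrt c = (p - ps) / Num.sqrt q +
   ps * (Num.sqrt c - Num.sqrt q) / (Num.sqrt q * Num.sqrt c).
  by field; rewrite !gt_eqF.
apply: le_trans (ler_normD _ _) _; apply: lerD.
  rewrite normrM ler_pM// normfV (gtr0_norm sq0) lef_pV2 ?posrE//.
have d : `|Num.sqrt c - Num.sqrt q| <= 3 * eta / k.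
  apply: le_trans (normr_sqrt_sub k0 kc q0 c0) _.
  by rewrite ler_pM2r ?invr_gt0// distrC.
rewrite normrM normrM normfV (gtr0_norm (mulr_gt0 sq0 sc0)).
rewrite [X in _ <= X](_ : _ = M * (3 * eta / k) / (k * k)); last by field; rewrite gt_eqF.
apply: ler_pM => //; rewrite ?mulr_ge0 ?invr_ge0 ?mulr_ge0 ?sqrtr_ge0//.
  by apply: ler_pM.
by rewrite lef_pV2 ?posrE ?mulr_gt0// ler_pM// ltW.
Qed.

(** Multiplying the rejection inequality by [sqrt s2], which is within [2 eta]
    of 1, costs at most [2 |z| eta]. *)
Lemma studentized_comparison eta dl dls e s2 N z : 0 <= eta -> 4 * eta <= 1 ->
  `|s2 - 1| <= 2 * eta -> `|dl - dls| <= e ->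
  (z < (dl + N) / Num.sqrt s2 -> z - dls - (e + 2 * `|z| * eta) < N) /\
  (~~ (z < (dl + N) / Num.sqrt s2) -> N <= z - dls + (e + 2 * `|z| * eta)).
Proof.
move=> eta0 eta4 s21 ddl.
have s20 : 0 < s2 by move: s21; rewrite ler_norml; lra.
have s0 : 0 < Num.sqrt s2 by rewrite sqrtr_gt0.
have ss : `|Num.sqrt s2 - 1| <= 2 * eta.
  apply: le_trans s21; rewrite -{2}(sqr_sqrtr (ltW s20)) -{2}(expr1n _ 2) subr_sqr normrM.
  by rewrite ler_peMr// (le_trans _ (ler_norm _))// lerDr sqrtr_ge0.
have zs : `|z * Num.sqrt s2 - z| <= 2 * `|z| * eta.
  have -> : z * Num.sqrt s2 - z = z * (Num.sqrt s2 - 1) by ring.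
  by rewrite normrM [X in _ <= X](_ : _ = `|z| * (2 * eta)); [rewrite ler_wpM2l|ring].
rewrite ltr_pdivlMr// -leNgt.
move: zs ddl; rewrite !ler_norml; move: (Num.sqrt s2) => s; set az := _ * eta.
by move=> /andP[h1 h2] /andP[h3 h4]; split=> h5; lra.
Qed.

End StudentizedComparison.

(** * Laws and concentration of the components *)

Section TestEvents.
Context {R : realType} {disp} {T : measurableType disp} {Pr : probability T R}.
Context {n d : nat} (X : 'I_n -> {RV Pr >-> d.-tuple R}).
Context {P : probability (d.-tuple R) R}.
Variables (m1 : nat) (mu : d.-tuple R) (S : 'M[R]_d) (lo hi : R).
Hypothesis m1n : (0 < m1 < n)%N.
Hypothesis hX : iid_sample X P.
Hypothesis hP : is_mvnormal P mu S.
Hypotheses (lo0 : 0 < lo) (hi0 : 0 < hi).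
Hypothesis hS : forall a, eigenvalue S a -> lo <= a <= hi.

Implicit Types (eta : R).

Local Notation m2 := (n - m1)%N.

Let tS : S^T = S. Proof. by have [] := hP. Qed.

Let S0 (a : d.-tuple R) : quadform S a = 0 -> forall k, tnth a k = 0.
Proof. exact: (quadform_eq0 tS lo0 hS). Qed.

Let m1_gt0 : 0 < m1%:R :> R.
Proof. by rewrite ltr0n; case/andP: m1n. Qed.

Let m2_gt0 : 0 < m2%:R :> R.
Proof. by rewrite ltr0n subn_gt0; case/andP: m1n. Qed.

Let x (w : T) (i : 'I_n) : d.-tuple R := X i w.
Let W (w : T) : d.-tuple R := second_sample_mean m1 (x w).
Local Notation form := (centered_form X mu).

Lemma second_sample_form b w :
  form (second_sample_coef n m1 b) w = \sum_k b 0 k * (tnth (W w) k - tnth mu k).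
Proof.
rewrite /centered_form exchange_big; apply: eq_bigr => k _.
rewrite tnth_mktuple.
transitivity (\sum_(i < n | (m1 <= i)%N) (m2%:R^-1 * b 0 k * tnth (x w i) k
    - m2%:R^-1 * b 0 k * tnth mu k)).
  rewrite [RHS]big_mkcond; apply: eq_bigr => i _; rewrite mxE.
  by case: ifP => _; rewrite ?mul0r// mulrBr.
rewrite sumrB sum_second_sample// -mulr_sumr; field; rewrite gt_eqF//.
Qed.

Lemma first_sample_form a v w :
  form (first_sample_coef n m1 a v) w = a * \sum_(i < n | (i < m1)%N) noise mu v (x w) i.
Proof.
rewrite mulr_sumr [RHS]big_mkcond; apply: eq_bigr => i _; case: ifPn => im.
  rewrite mulr_sumr; apply: eq_bigr => k _; rewrite mxE im mulrA//.
by rewrite big1// => k _; rewrite mxE (negbTE im) mul0r.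
Qed.

Lemma observation_form a v s w :
  form (observation_coef a v s) w = a * noise mu v (x w) s.
Proof.
rewrite /centered_form (bigD1 s)//= [X in _ + X]big1 ?addr0 => [|i /negbTE is_]; last first.
  by rewrite big1// => k _; rewrite mxE is_ mul0r.
by rewrite mulr_sumr; apply: eq_bigr => k _; rewrite mxE eqxx mulrA.
Qed.

Lemma centered_form_chebyshev A eta : 0 < eta ->
  (Pr [set w | (eta < `|form A w|)%R] <= (covariance_form S A A / eta ^+ 2)%:E)%E.
Proof.
move=> eta0; apply: has_mean_chebyshev => //; first exact: measurable_centered_form.
exact: (centered_form_moment2 hX hP S0).
Qed.

(** The drift is a linear form of the second sample with variance
    [m1 mu^T S mu / m2]. *)
Lemma drift_concentration eta : 0 < eta ->
  (Pr [set w | (eta < `|Num.sqrt m1%:R * dotp (W w) mu - Num.sqrt m1%:R * dotp mu mu|)%R]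
   <= (m1%:R / m2%:R * hi * dotp mu mu / eta ^+ 2)%:E)%E.
Proof.
move=> eta0; pose b : 'rV[R]_d := \row_k (Num.sqrt m1%:R * tnth mu k).
have bE w : form (second_sample_coef n m1 b) w =
    Num.sqrt m1%:R * dotp (W w) mu - Num.sqrt m1%:R * dotp mu mu.
  rewrite second_sample_form -mulrBr /dotp -sumrB mulr_sumr.
  by apply: eq_bigr => k _; rewrite mxE; ring.
rewrite (_ : mkset _ = [set w | (eta < `|form (second_sample_coef n m1 b) w|)%R]); last first.
  by apply/seteqP; split => w /=; rewrite bE.
apply: le_trans (centered_form_chebyshev _ eta0) _.
rewrite lee_fin ler_pM2r ?invr_gt0 ?exprn_gt0// second_sample_covariance//.
have -> : bform S b b = m1%:R * quadform S mu.
  have -> : b = Num.sqrt m1%:R *: row_of_tuple mu by apply/rowP => k; rewrite !mxE.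
  by rewrite bformZl bformC// bformZl mulrA -expr2 sqr_sqrtr// quadformE.
rewrite mulrA [m2%:R^-1 * _]mulrC -mulrA ler_pM2l ?divr_gt0//.
exact: (quadform_hi tS hS).
Qed.

Let Y w k := tnth (W w) k - tnth mu k.

Lemma cross_term_concentration eta : 0 < eta ->
  (Pr [set w | (eta < `|2 * \sum_k (\sum_l tnth mu l * S l k) * Y w k|)%R]
   <= (4 * hi ^+ 3 * dotp mu mu / m2%:R / eta ^+ 2)%:E)%E.
Proof.
move=> eta0; pose b : 'rV[R]_d := 2 *: row_of_tuple (mulmx_tuple S mu).
have bE w : form (second_sample_coef n m1 b) w =
    2 * \sum_k (\sum_l tnth mu l * S l k) * Y w k.
  rewrite second_sample_form mulr_sumr; apply: eq_bigr => k _.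
  by rewrite !mxE tnth_mktuple mulrA.
rewrite (_ : mkset _ = [set w | (eta < `|form (second_sample_coef n m1 b) w|)%R]); last first.
  by apply/seteqP; split => w /=; rewrite bE.
apply: le_trans (centered_form_chebyshev _ eta0) _.
rewrite lee_fin ler_pM2r ?invr_gt0 ?exprn_gt0// second_sample_covariance//.
rewrite mulrC ler_pM2r ?invr_gt0// bformZl bformC// bformZl -quadformE mulrA.
rewrite -mulrA [leLHS]mulrA -[leRHS]mulrA (_ : 2 * 2 = 4 :> R); last by rewrite -natrM.
by rewrite ler_pM2l//; exact: (quadform_mulmx_le tS lo0 hi0 hS).
Qed.

Let c := \tr (S *m S) / m2%:R.

(** Chebyshev's inequality with the variance given by
    [wick_quadratic_variance]: for covariance [S / m2] both pairings are equal to
    [tr (S^4) / m2^2]. *)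
Lemma quadratic_term_concentration eta : 0 < eta ->
  (Pr [set w | (eta < `|\sum_k \sum_l S k l * (Y w k * Y w l) - c|)%R]
   <= (2 * hi ^+ 4 * d%:R / m2%:R ^+ 2 / eta ^+ 2)%:E)%E.
Proof.
move=> eta0; pose u k := second_sample_coef n m1 (delta_mx 0 k : 'rV[R]_d).
have uE k w : form (u k) w = Y w k.
  rewrite second_sample_form (bigD1 k)//= mxE !eqxx mul1r big1 ?addr0// => l lk.
  by rewrite mxE (negbTE lk) mul0r.
have uB k l : covariance_form S (u k) (u l) = m2%:R^-1 * S k l.
  by rewrite second_sample_covariance// bformE -rowE trmx_delta -colE !mxE.
have h := centered_quadratic_variance hX hP S0 (fun k l => S k l) u.
have meanE : \sum_k \sum_l S k l * covariance_form S (u k) (u l) = c.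
  rewrite /c /mxtrace mulr_suml; apply: eq_bigr => k _; rewrite mxE mulr_suml.
  by apply: eq_bigr => l _; rewrite uB -[in S l k]tS mxE; ring.
rewrite meanE in h.
have mY k : measurable_fun setT (fun w => Y w k).
  apply: measurable_funB => //; apply: measurable_fun_tnth.
  by apply: measurable_second_sample_mean => i _; exact: measurable_funP.
have h2 := has_mean_chebyshev _ eta0 h.
rewrite (_ : mkset _ = [set w | eta < `|\sum_s \sum_t S s t * (form (u s) w * form (u t) w) - c|]).
  apply: le_trans (h2 _) _.
    apply: measurable_funB => //; apply: measurable_sum => k; apply: measurable_sum => l.
    apply: measurable_funM => //; apply: measurable_funM; exact: measurable_centered_form.
  rewrite lee_fin ler_pM2r ?invr_gt0 ?exprn_gt0//.
  have symS i j : S i j = S j i by rewrite -[in LHS]tS mxE.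
  have sumSS1 : \sum_s \sum_t \sum_s' \sum_t' S s t * S s' t' * (S s s' * S t t') =
      \sum_s \sum_t ((S *m S) s t) ^+ 2.
    apply: eq_bigr => s _.
    under eq_bigr do rewrite exchange_big.
    rewrite exchange_big; apply: eq_bigr => t' _.
    rewrite expr2 !mxE big_distrlr; apply: eq_bigr => t _; apply: eq_bigr => s' _ /=; ring.
  have sumSS2 : \sum_s \sum_t \sum_s' \sum_t' S s t * S s' t' * (S s t' * S t s') =
      \sum_s \sum_t ((S *m S) s t) ^+ 2.
    apply: eq_bigr => s _; rewrite exchange_big; apply: eq_bigr => s' _.
    rewrite expr2 !mxE big_distrlr; apply: eq_bigr => t _; apply: eq_bigr => t' _ /=.
    by rewrite (symS s' t'); ring.
  apply: le_trans (_ : (1 + 1) * m2%:R^-1 ^+ 2 * \sum_s \sum_t ((S *m S) s t) ^+ 2 <= _).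
    rewrite le_eqVlt; apply/orP; left; apply/eqP.
    rewrite mulrDl mulrDl mul1r -{1}sumSS1 -sumSS2.
    rewrite !mulr_sumr -big_split; apply: eq_bigr => s _; rewrite !mulr_sumr -big_split.
    apply: eq_bigr => t _; rewrite !mulr_sumr -big_split; apply: eq_bigr => s' _.
    rewrite !mulr_sumr -big_split; apply: eq_bigr => t' _ /=; rewrite !uB; ring.
  rewrite [leRHS](_ : _ = (1 + 1) * m2%:R^-1 ^+ 2 * (hi ^+ 4 * d%:R)); last first.
    by field; rewrite gt_eqF.
  rewrite ler_pM2l ?mulr_gt0 ?exprn_gt0 ?invr_gt0//.
  exact: (sum_sqr_mulmx_le tS lo0 hi0 hS).
have QE w : \sum_s \sum_t S s t * (form (u s) w * form (u t) w) =
    \sum_s \sum_t S s t * (Y w s * Y w t).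
  by apply: eq_bigr => s _; apply: eq_bigr => t _; rewrite !uE.
by apply/seteqP; split => w /=; rewrite QE.
Qed.

Let second (i : 'I_n) := (m1 <= i)%N.
Let first (i : 'I_n) := (i < m1)%N.
Let S2 : measurableType _ := g_sigma_algebraType (cylinders X second).
Let S1 : measurableType _ := g_sigma_algebraType (cylinders X first).

Let mW2 : measurable_fun [set: S2 * S1] (fun z => W z.1).
Proof.
apply: measurable_second_sample_mean => i im.
by apply: measurableT_comp measurable_fst; exact: measurable_sample.
Qed.

Let mx1 (i : 'I_n) : (i < m1)%N -> measurable_fun [set: S2 * S1] (fun z => x z.2 i).
Proof.
by move=> im; apply: measurableT_comp measurable_snd; exact: measurable_sample.
Qed.

Let sample_split (E : set (S2 * S1)) (p : \bar R) : measurable E ->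
  (forall w, Pr [set y | E (w, y)] <= p)%E -> (Pr [set w | E (w, w)] <= p)%E.
Proof.
by move=> mE; apply: (sample_freeze_le hX) => // i; rewrite /second/= /first/=; case: ltnP.
Qed.

Let mpos : measurable [set z : S2 * S1 | 0 < quadform S (W z.1)].
Proof. by apply: measurable_lt_set => //; exact: measurable_quadform. Qed.

(** With [W] frozen the standardized mean is a linear form of unit variance in
    the first sample. Only an upper bound is needed, since it is applied to a
    half-line and to its complement. *)
Lemma standardized_mean_law (B : set R) : measurable B ->
  (Pr [set w | (0 < quadform S (W w))%R /\ B (standardized_mean m1 mu S (W w) (x w))]
   <= normal_prob 0 1 B)%E.
Proof.
move=> mB.
pose E : set (S2 * S1) := [set z | 0 < quadform S (W z.1)] `&`
   [set z | B (standardized_mean m1 mu S (W z.1) (x z.2))].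
have mE : measurable E.
  have mN : measurable_fun [set: S2 * S1]
    (fun z => standardized_mean m1 mu S (W z.1) (x z.2)).
    by apply: measurable_standardized_mean; [exact: mW2|exact: mx1].
  by apply: measurableI => //; rewrite -[X in measurable X]setTI; exact: mN.
apply: (sample_split mE) => w.
have [q0|q0] := ltP 0 (quadform S (W w)); last first.
  rewrite (_ : [set y | E (w, y)] = set0) ?measure0//.
  by apply/seteqP; split => // y [/= + _]; rewrite ltNge q0.
pose a : R := (Num.sqrt m1%:R * stdev S (W w))^-1.
have s0 : 0 < stdev S (W w) by rewrite sqrtr_gt0.
have <- : Pr [set y | B (form (first_sample_coef n m1 a (W w)) y)] = normal_prob 0 1 B.
  have E1 : covariance_form S (first_sample_coef n m1 a (W w)) (first_sample_coef n m1 a (W w)) = 1.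
    rewrite first_sample_covariance//.
    rewrite /a invfM exprMn !exprVn !sqr_sqrtr ?ltW//.
    by field; rewrite !gt_eqF.
  by rewrite (centered_form_law hX hP S0)// E1 ?oner_eq0// sqrtr1.
rewrite (_ : [set y | E (w, y)] = [set y | B (form (first_sample_coef n m1 a (W w)) y)])//.
by apply/seteqP; split => y; rewrite /E/= first_sample_form /standardized_mean -/a mulrC;
  [case|split].
Qed.

(** With [W] frozen this is a quadratic form in [m1] uncorrelated linear forms
    of unit variance, with mean [1 - 1 / m1]. *)
Lemma standardized_variance_concentration eta : 0 < eta ->
  (Pr [set w | (0 < quadform S (W w))%R /\
      (eta < `|standardized_variance m1 mu S (W w) (x w) - (1 - m1%:R^-1)|)%R]
   <= (2 / m1%:R / eta ^+ 2)%:E)%E.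
Proof.
move=> eta0.
pose E : set (S2 * S1) := [set z | 0 < quadform S (W z.1)] `&`
   [set z | eta < `|standardized_variance m1 mu S (W z.1) (x z.2) - (1 - m1%:R^-1)|].
have mE : measurable E.
  apply: measurableI => //; apply: measurable_lt_set => //.
  apply: measurableT_comp => //; apply: measurable_funB => //.
  by apply: measurable_standardized_variance; [exact: mW2|exact: mx1].
apply: (sample_split mE) => w.
have [q0|q0] := ltP 0 (quadform S (W w)); last first.
  rewrite (_ : [set y | E (w, y)] = set0) ?measure0// ?lee_fin ?divr_ge0 ?exprn_ge0// ?ltW//.
  by apply/seteqP; split => // y [/= + _]; rewrite ltNge q0.
have s0 : 0 < stdev S (W w) by rewrite sqrtr_gt0.
pose u (s : 'I_n) := observation_coef (stdev S (W w))^-1 (W w) s.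
have uB s t : covariance_form S (u s) (u t) = (s == t)%:R.
  rewrite observation_covariance; case: eqP => // _.
  by rewrite exprVn sqr_sqrtr ?ltW// mulVf ?gt_eqF.
pose C := sample_variance_coef R m1 : 'I_n -> 'I_n -> R.
have deltaE (F : 'I_n -> R) t : \sum_i F i * (t == i)%:R = F t.
  rewrite (bigD1 t)//= eqxx mulr1 big1 ?addr0// => i it.
  by rewrite eq_sym (negbTE it) mulr0.
have h := centered_quadratic_variance hX hP S0 C u.
have meanE : \sum_s \sum_t C s t * covariance_form S (u s) (u t) = 1 - m1%:R^-1.
  rewrite -(sum_sample_variance_coef_diag R m1n); apply: eq_bigr => s _.
  by under eq_bigr do rewrite uB; rewrite deltaE.
rewrite meanE in h.
have varE : \sum_s \sum_t \sum_s' \sum_t' C s t * C s' t' *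
   (covariance_form S (u s) (u s') * covariance_form S (u t) (u t') +
    covariance_form S (u s) (u t') * covariance_form S (u t) (u s')) =
   2 * \sum_s \sum_t C s t ^+ 2.
  rewrite mulr_sumr; apply: eq_bigr => s _; rewrite mulr_sumr; apply: eq_bigr => t _.
  transitivity (\sum_s' \sum_t' C s t * C s' t' * (t == t')%:R * (s == s')%:R +
    \sum_s' \sum_t' C s t * C s' t' * (s == t')%:R * (t == s')%:R).
    rewrite -big_split; apply: eq_bigr => s' _; rewrite -big_split; apply: eq_bigr => t' _ /=.
    by rewrite !uB; ring.
  have symC i j : C i j = C j i by rewrite /C /sample_variance_coef andbC eq_sym.
  under eq_bigr do rewrite -mulr_suml deltaE; rewrite deltaE.
  under eq_bigr do rewrite -mulr_suml deltaE; rewrite deltaE.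
  by rewrite (symC t s); ring.
rewrite varE in h.
have h2 := has_mean_chebyshev _ eta0 h.
have QE y : standardized_variance m1 mu S (W w) (x y) =
    \sum_s \sum_t C s t * (form (u s) y * form (u t) y).
  rewrite /standardized_variance sample_variance_coefE//.
  apply: eq_bigr => s _; apply: eq_bigr => t _.
  by rewrite !observation_form ![_^-1 * _]mulrC.
rewrite (_ : [set y | E (w, y)] = [set y | eta <
   `|\sum_s \sum_t C s t * (form (u s) y * form (u t) y) - (1 - m1%:R^-1)|]).
  apply: le_trans (h2 _) _.
    apply: measurable_funB => //; apply: measurable_sum => k; apply: measurable_sum => l.
    apply: measurable_funM => //; apply: measurable_funM; exact: measurable_centered_form.
  rewrite lee_fin ler_pM2r ?invr_gt0 ?exprn_gt0// ler_pM2l//.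
  exact: sum_sample_variance_coef_sqr.
by apply/seteqP; split => y; rewrite /E/= QE; [case|split].
Qed.

End TestEvents.

(** * Power at a fixed sample size *)

Section NonasymptoticPower.
Context {R : realType} {disp} {T : measurableType disp} {Pr : probability T R}.
Context {n d : nat} (X : 'I_n -> {RV Pr >-> d.-tuple R}).
Context {P : probability (d.-tuple R) R}.
Variables (m1 : nat) (mu : d.-tuple R) (S : 'M[R]_d) (lo hi : R).
Hypothesis m1n : (0 < m1 < n)%N.
Hypothesis hX : iid_sample X P.
Hypothesis hP : is_mvnormal P mu S.
Hypotheses (lo0 : 0 < lo) (hi0 : 0 < hi).
Hypothesis hS : forall a, eigenvalue S a -> lo <= a <= hi.

Implicit Types (eta : R).

Local Notation m2 := (n - m1)%N.

Let tS : S^T = S. Proof. by have [] := hP. Qed.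

Let x (w : T) (i : 'I_n) : d.-tuple R := X i w.
Let W (w : T) : d.-tuple R := second_sample_mean m1 (x w).
Let Y w k := tnth (W w) k - tnth mu k.
Let c := \tr (S *m S) / m2%:R.
Let q0 := dotp mu mu.

(** Expansion of the quadratic form around the mean [mu]. *)
Lemma quadform_expand w : quadform S (W w) =
  (\sum_k \sum_l S k l * (Y w k * Y w l)) +
  2 * \sum_k (\sum_l tnth mu l * S l k) * Y w k + quadform S mu.
Proof.
have symS i j : S i j = S j i by rewrite -[in LHS]tS mxE.
have e1 : \sum_k (\sum_l tnth mu l * S l k) * Y w k =
    \sum_k \sum_l tnth mu k * S k l * Y w l.
  rewrite [RHS]exchange_big; apply: eq_bigr => k _; rewrite mulr_suml.
  by apply: eq_bigr => l _.
have e2 : \sum_k (\sum_l tnth mu l * S l k) * Y w k =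
    \sum_k \sum_l tnth mu l * S k l * Y w k.
  apply: eq_bigr => k _; rewrite mulr_suml.
  by apply: eq_bigr => l _; rewrite (symS l k).
rewrite (_ : 2 = 1 + 1)// mulrDl mul1r {1}e1 e2 -!big_split; apply: eq_bigr => k _ /=.
rewrite -!big_split; apply: eq_bigr => l _ /=.
by rewrite /Y; ring.
Qed.

Let bad eta := [set w | (eta < `|Num.sqrt m1%:R * dotp (W w) mu - Num.sqrt m1%:R * q0|)%R] `|`
  ([set w | (eta < `|\sum_k \sum_l S k l * (Y w k * Y w l) - c|)%R] `|`
  ([set w | (eta < `|2 * \sum_k (\sum_l tnth mu l * S l k) * Y w k|)%R] `|`
   [set w | (0 < quadform S (W w))%R /\
      (eta < `|standardized_variance m1 mu S (W w) (x w) - (1 - m1%:R^-1)|)%R])).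

Let V := m1%:R / m2%:R * hi * q0 + 2 * hi ^+ 4 * d%:R / m2%:R ^+ 2 +
   4 * hi ^+ 3 * q0 / m2%:R + 2 / m1%:R.

Let mx i : measurable_fun setT (fun w => x w i).
Proof. exact: measurable_funP. Qed.

Let mW : measurable_fun setT W.
Proof. by apply: measurable_second_sample_mean => i _. Qed.

Let mY k : measurable_fun setT (fun w => Y w k).
Proof. by apply: measurable_funB => //; exact: measurable_fun_tnth. Qed.

Let m_drift eta : measurable
  [set w | (eta < `|Num.sqrt m1%:R * dotp (W w) mu - Num.sqrt m1%:R * q0|)%R].
Proof.
apply: measurable_lt_set => //; apply: measurableT_comp => //; apply: measurable_funB => //.
by apply: measurable_funM => //; exact: measurable_dotp.
Qed.

Let m_quadratic eta : measurable
  [set w | (eta < `|\sum_k \sum_l S k l * (Y w k * Y w l) - c|)%R].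
Proof.
apply: measurable_lt_set => //; apply: measurableT_comp => //; apply: measurable_funB => //.
apply: measurable_sum => k; apply: measurable_sum => l.
by apply: measurable_funM => //; exact: measurable_funM.
Qed.

Let m_cross eta : measurable
  [set w | (eta < `|2 * \sum_k (\sum_l tnth mu l * S l k) * Y w k|)%R].
Proof.
apply: measurable_lt_set => //; apply: measurableT_comp => //; apply: measurable_funM => //.
by apply: measurable_sum => k; apply: measurable_funM.
Qed.

Let m_pos : measurable [set w | (0 < quadform S (W w))%R].
Proof. by apply: measurable_lt_set => //; exact: measurable_quadform. Qed.

Let m_variance eta : measurable [set w | (0 < quadform S (W w))%R /\
      (eta < `|standardized_variance m1 mu S (W w) (x w) - (1 - m1%:R^-1)|)%R].
Proof.
apply: measurableI => //; apply: measurable_lt_set => //.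
apply: measurableT_comp => //; apply: measurable_funB => //.
exact: measurable_standardized_variance.
Qed.

Let m_bad eta : measurable (bad eta).
Proof. by apply: measurableU => //; apply: measurableU => //; apply: measurableU. Qed.

(** Each of the four events is controlled by Chebyshev's inequality. *)
Let bad_le eta : 0 < eta -> (Pr (bad eta) <= (V / eta ^+ 2)%:E)%E.
Proof.
move=> eta0; 
have -> : V / eta ^+ 2 = m1%:R / m2%:R * hi * q0 / eta ^+ 2 +
    (2 * hi ^+ 4 * d%:R / m2%:R ^+ 2 / eta ^+ 2 +
     (4 * hi ^+ 3 * q0 / m2%:R / eta ^+ 2 + 2 / m1%:R / eta ^+ 2)).
  by rewrite -!(mulrDl _ _ (eta ^+ 2)^-1) !addrA.
rewrite !EFinD.
have U (A B : set T) a b : measurable A -> measurable B ->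
   (Pr A <= a -> Pr B <= b -> Pr (A `|` B) <= a + b)%E.
  by move=> mA mB Aa Bb; apply: le_trans (measureU2 _ mA mB) _; exact: leeD.
apply: (U) => //; first by apply: measurableU => //; apply: measurableU.
  exact: (drift_concentration m1n hX hP lo0 hS).
apply: (U) => //; first by apply: measurableU.
  exact: (quadratic_term_concentration m1n hX hP lo0 hi0 hS).
apply: (U) => //.
  exact: (cross_term_concentration m1n hX hP lo0 hi0 hS).
exact: (standardized_variance_concentration m1n hX hP lo0 hS).
Qed.

Variables (z eta k M : R).
Hypotheses (eta0 : 0 < eta) (eta4 : 4 * eta <= 1) (m1_eta : m1%:R^-1 <= eta).
Hypotheses (mu_eta : quadform S mu <= eta) (k0 : 0 < k) (kc : k ^+ 2 + 3 * eta <= c).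
Hypothesis (q0M : Num.sqrt m1%:R * q0 <= M).

Let dls := Num.sqrt m1%:R * q0 / Num.sqrt c.
Let e := eta / k + 3 * M * eta / k ^+ 3 + 2 * `|z| * eta.
Let Nw w := standardized_mean m1 mu S (W w) (x w).

(** Outside the bad event the frozen variance is within [3 eta] of its limit [c],
    hence at least [k^2], and the empirical variance is within [2 eta] of 1. *)
Let good_event w : ~ bad eta w -> [/\ 0 < quadform S (W w),
  z < T_mean m1 (x w) -> z - dls - e < Nw w &
  ~~ (z < T_mean m1 (x w)) -> Nw w <= z - dls + e].
Proof.
move=> /not_orP[/= /negP b1 /not_orP[/negP b2 /not_orP[/negP b3 b4]]].
rewrite -leNgt in b1; rewrite -leNgt in b2; rewrite -leNgt in b3.
have [_ posS _] := hP.
have qc : `|quadform S (W w) - c| <= 3 * eta.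
  have := quadform_expand w.
  set A := (X in X + _ + _); set B := 2 * _ => ->.
  have b2' : `|A - c| <= eta by exact: b2.
  have b3' : `|B| <= eta by exact: b3.
  have -> : A + B + quadform S mu - c = (A - c) + B + quadform S mu by ring.
  have -> : 3 * eta = eta + eta + eta by ring.
  apply: le_trans (ler_normD _ _) _; apply: lerD; last by rewrite ger0_norm.
  by apply: le_trans (ler_normD _ _) _; apply: lerD.
have kk : 0 < k ^+ 2 by rewrite exprn_gt0.
have kq : k ^+ 2 <= quadform S (W w).
  rewrite -(lerD2r (3 * eta)); apply: (le_trans kc); rewrite -lerBlDl.
  by apply: le_trans (ler_norm _) _; rewrite distrC.
have qpos : 0 < quadform S (W w) by exact: lt_le_trans kq.
have kc' : k ^+ 2 <= c by apply: le_trans kc; rewrite lerDl mulr_ge0// ltW.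
have cpos : 0 < c by exact: lt_le_trans kc'.
have sv : `|standardized_variance m1 mu S (W w) (x w) - 1| <= 2 * eta.
  have : ~ (eta < `|standardized_variance m1 mu S (W w) (x w) - (1 - m1%:R^-1)|).
    by move=> h; apply: b4.
  move=> /negP; rewrite -leNgt => h.
  have -> : 2 * eta = eta + eta by ring.
  rewrite (_ : _ - 1 = (standardized_variance m1 mu S (W w) (x w) - (1 - m1%:R^-1)) - m1%:R^-1);
    last by ring.
  by apply: le_trans (ler_normB _ _) _; apply: lerD => //; rewrite ger0_norm ?invr_ge0.
have sqk a : k ^+ 2 <= a -> k <= Num.sqrt a.
  move=> ka; have a0 : 0 < a by exact: lt_le_trans ka.
  by rewrite -[leLHS](ger0_norm (ltW k0)) -sqrtr_sqr ler_sqrt ?(ltW a0).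
have q00 : 0 <= Num.sqrt m1%:R * q0.
  rewrite mulr_ge0 ?sqrtr_ge0//; apply: sumr_ge0 => i _; rewrite -expr2; exact: sqr_ge0.
have M0 : `|Num.sqrt m1%:R * q0| <= M by rewrite ger0_norm.
have h := ratio_sqrt_perturbation k0 (ltW eta0) (sqk _ kq) (sqk _ kc') M0 b1 qc
  (ltW qpos) (ltW cpos).
have [h1 h2] := studentized_comparison (Nw w) z (ltW eta0) eta4 sv h.
by rewrite (T_meanE mu m1n qpos); split.
Qed.

Let rejection := [set w | (z < T_mean m1 (x w))%R].

Let m_rejection : measurable rejection.
Proof. by apply: measurable_lt_set => //; exact: measurable_T_mean. Qed.

(** Outside an event of probability at most [V / eta^2] the rejection event lies
    between two half-lines for the standardized mean, at distance [e] on either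
    side of [z - dls]; their probabilities differ from [Phi (dls - z)] by at most
    [e]. *)
Lemma rejection_probability_bound :
  `|fine (Pr rejection) - Phi (dls - z)| <= e + V / eta ^+ 2.
Proof.
have fE (A : set T) : measurable A -> (fine (Pr A))%:E = Pr A.
  by move=> mA; rewrite fineK// fin_num_measure.
have mN : measurable_fun setT Nw by exact: measurable_standardized_mean.
have e0 : 0 <= e.
  have M0 : 0 <= M.
    apply: le_trans q0M; rewrite mulr_ge0 ?sqrtr_ge0//.
    by apply: sumr_ge0 => i _; rewrite -expr2; exact: sqr_ge0.
  by rewrite /e !addr_ge0 ?divr_ge0 ?mulr_ge0 ?exprn_ge0// ltW.
have up : fine (Pr rejection) <= 1 - Phi (z - dls - e) + V / eta ^+ 2.
  rewrite -lee_fin fE// EFinD.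
  apply: le_trans (_ : Pr ([set w | (0 < quadform S (W w))%R /\ [set y | (z - dls - e < y)%R] (Nw w)]
      `|` bad eta) <= _)%E.
    apply: le_measure; rewrite ?inE//.
      apply: measurableU => //; apply: measurableI => //.
      by apply: measurable_lt_set.
    move=> w /= zT; have [b|/good_event[g1 g2 _]] := pselect (bad eta w); first by right.
    by left; split => //; exact: g2.
  apply: le_trans (measureU2 _ _ _) _ => //.
    by apply: measurableI => //; apply: measurable_lt_set.
  apply: leeD; last exact: bad_le.
  have <- := @normal_prob_tail R 0 (z - dls - e).
  rewrite (_ : [set y | 0 + _ < y] = [set y | z - dls - e < y]); last by rewrite add0r.
  apply: (standardized_mean_law m1n hX hP lo0 hS).
  by apply: measurable_lt_set.
have lw : 1 - fine (Pr rejection) <= Phi (z - dls + e) + V / eta ^+ 2.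
  rewrite -lee_fin EFinB fE// EFinD -probability_setC//.
  apply: le_trans (_ : Pr ([set w | (0 < quadform S (W w))%R /\ `]-oo, (z - dls + e)%R]%classic (Nw w)]
      `|` bad eta) <= _)%E.
    apply: le_measure; rewrite ?inE//.
    - exact: measurableC.
    - apply: measurableU => //; apply: measurableI => //.
      by rewrite -[X in measurable X]setTI; exact: mN.
    move=> w /= zT; have [b|/good_event[g1 _ g2]] := pselect (bad eta w); first by right.
    by left; split => //=; rewrite in_itv/=; apply: g2; apply/negP.
  apply: le_trans (measureU2 _ _ _) _ => //.
    apply: measurableI => //.
    by rewrite -[X in measurable X]setTI; exact: mN.
  apply: leeD; last exact: bad_le.
  rewrite PhiE; exact: (standardized_mean_law m1n hX hP lo0 hS).
have := @Phi_lipschitz R (dls - z) (dls - z + e) ltac:(lra).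
have := @Phi_lipschitz R (dls - z - e) (dls - z) ltac:(lra).
move: up lw; rewrite -PhiN.
rewrite (_ : - (z - dls - e) = dls - z + e); last by ring.
have -> : Phi (z - dls + e) = 1 - Phi (dls - z - e).
  by rewrite -PhiN; congr Phi; ring.
by rewrite ler_norml; lra.
Qed.

End NonasymptoticPower.

(** * Rates of convergence *)

Section PowerOfTheTest.
Context {R : realType} {disp} {T : measurableType disp} {Pr : probability T R}.
Context {n d : nat} (X : 'I_n -> {RV Pr >-> d.-tuple R}).

Lemma power_meanE (m1 : nat) (alpha : R) : power_mean X m1 alpha =
  fine (Pr [set w | zquantile (1 - alpha) < T_mean m1 (fun i => X i w)]).
Proof.
rewrite /power_mean; congr fine.
have mA : measurable [set w | zquantile (1 - alpha) < T_mean m1 (fun i => X i w)].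
  by apply: measurable_lt_set => //; apply: measurable_T_mean => i; exact: measurable_funP.
rewrite -expectation_indic//; congr expectation; apply/funext => w.
rewrite /phi_mean indicE; case: ifPn => h; first by rewrite mem_set.
by rewrite memNset//; exact/negP.
Qed.

End PowerOfTheTest.

Section Rates.
Variable R : realType.
Implicit Types (n m d : nat) (hi b tau kap M q s : R).

Lemma sqrt_natr_div n d : (0 < n)%N ->
  Num.sqrt d%:R / n%:R = Num.sqrt (d%:R / n%:R) * Num.sqrt n%:R^-1 :> R.
Proof.
move=> n0; have np : 0 < n%:R :> R by rewrite ltr0n.
rewrite sqrtrM// -mulrA; congr (_ * _).
by rewrite -expr2 sqr_sqrtr// invr_ge0 ltW.
Qed.

(** Every term is [O(q)] or [O(1 / n)], and both are [O(s)] since [s <= 1]. *)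
Lemma variance_rate n (m1 : nat) d hi b tau kap M q : (0 < n)%N -> (0 < m1 < n)%N ->
  0 < b -> 0 < kap -> 0 <= hi -> 0 <= q -> 0 <= tau -> 0 <= M ->
  kap * n%:R <= m1%:R -> b * n%:R <= (n - m1)%:R -> d%:R <= tau * n%:R ->
  let s := Num.sqrt n%:R^-1 in q <= M * s -> s <= 1 ->
  m1%:R / (n - m1)%:R * hi * q + 2 * hi ^+ 4 * d%:R / (n - m1)%:R ^+ 2 +
    4 * hi ^+ 3 * q / (n - m1)%:R + 2 / m1%:R <=
  (hi * M / b + 2 * hi ^+ 4 * tau / b ^+ 2 + 4 * hi ^+ 3 * M + 2 / kap) * s.
Proof.
move=> n0 /andP[m10 m1n] b0 kap0 hi0 q0 tau0 M0 km1 bm2 dn s qs s1.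
have np : 0 < n%:R :> R by rewrite ltr0n.
have m1p : 0 < m1%:R :> R by rewrite ltr0n.
have m2n1 : (1 <= n - m1)%N by rewrite subn_gt0.
have m2p : 0 < (n - m1)%:R :> R by rewrite ltr0n.
have m2ge1 : 1 <= (n - m1)%:R :> R by rewrite ler1n.
have s0 : 0 <= s by exact: sqrtr_ge0.
have sE : s ^+ 2 = n%:R^-1 by rewrite sqr_sqrtr// invr_ge0 ltW.
have ss : n%:R^-1 <= s by rewrite -sE expr2 ler_piMr.
have bnp : 0 < b * n%:R by rewrite mulr_gt0.
rewrite 3!(mulrDl _ _ s); apply: lerD; [apply: lerD; [apply: lerD|]|].
- have -> : hi * M / b * s = b^-1 * hi * (M * s) by ring.
  apply: ler_pM => //; first by rewrite mulr_ge0 ?divr_ge0.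
  rewrite ler_wpM2r// ler_pdivrMr// (le_trans _ (ler_wpM2l _ bm2)) ?invr_ge0 ?(ltW b0)//.
  by rewrite mulKf ?gt_eqF// ler_nat ltnW.
- have -> : 2 * hi ^+ 4 * tau / b ^+ 2 * s = 2 * hi ^+ 4 * (tau / b ^+ 2 * s) by ring.
  rewrite -(mulrA (2 * hi ^+ 4)) ler_wpM2l ?mulr_ge0 ?exprn_ge0//.
  apply: le_trans (_ : (tau * n%:R) / (b * n%:R) ^+ 2 <= _).
    have h1 : ((n - m1)%:R ^+ 2)^-1 <= ((b * n%:R) ^+ 2)^-1.
      by rewrite lef_pV2 ?posrE ?exprn_gt0// lerXn2r ?nnegrE ?(ltW bnp) ?(ltW m2p).
    by apply: ler_pM => //; rewrite invr_ge0 exprn_ge0.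
  have -> : tau * n%:R / (b * n%:R) ^+ 2 = tau / b ^+ 2 * n%:R^-1.
    by field; rewrite !gt_eqF.
  by rewrite ler_wpM2l// mulr_ge0// invr_ge0 exprn_ge0// ltW.
- apply: le_trans (_ : 4 * hi ^+ 3 * q <= _).
    by rewrite ler_pdivrMr// ler_peMr// !mulr_ge0// exprn_ge0.
  by rewrite -[leRHS]mulrA ler_wpM2l// mulr_ge0// exprn_ge0.
- rewrite -mulrA ler_wpM2l//; apply: le_trans (_ : kap^-1 * n%:R^-1 <= _).
    by rewrite -invfM lef_pV2 ?posrE ?mulr_gt0.
  by rewrite ler_wpM2l// invr_ge0 ltW.
Qed.

End Rates.

Section OneSampleSize.
Context {R : realType} {disp} {T : measurableType disp} {Pr : probability T R}.
Context {n d : nat} (X : 'I_n -> {RV Pr >-> d.-tuple R}).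
Context {P : probability (d.-tuple R) R}.
Variables (m1 : nat) (mu : d.-tuple R) (S : 'M[R]_d) (lo hi : R).
Hypothesis m1n : (0 < m1 < n)%N.
Hypothesis hX : iid_sample X P.
Hypothesis hP : is_mvnormal P mu S.
Hypotheses (lo0 : 0 < lo) (hi0 : 0 < hi).
Hypothesis hS : forall a, eigenvalue S a -> lo <= a <= hi.

(** All conditions on the sample size are bounds on [s = 1 / sqrt n] and on the
    ratios [d / n] and [m1 / n], so that in the limit [eta] can be chosen first,
    depending on [eps], and [n] afterwards. The terms of the final bound are the
    perturbation, the bad event, and the replacement of [sqrt (m1 m2)] by
    [n sqrt (kappa (1 - kappa))]. *)
Lemma power_near_limit (alpha kappa C taul tauh b kap eta eps : R) :
  0 < alpha < 1 -> 0 < taul -> 0 <= C -> 0 < b -> 0 < kap -> 0 <= tauh ->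
  taul * n%:R <= d%:R -> d%:R <= tauh * n%:R ->
  kap * n%:R <= m1%:R -> b * n%:R <= (n - m1)%:R ->
  dotp mu mu <= C * (Num.sqrt d%:R / n%:R) ->
  let s := Num.sqrt n%:R^-1 in
  let M := C * Num.sqrt tauh in
  let k := lo * Num.sqrt (taul / 2) in
  let z := zquantile (1 - alpha) in
  s <= 1 -> s / kap <= eta -> hi * (M * s) <= eta ->
  0 < eta -> 4 * eta <= 1 -> 3 * eta <= lo ^+ 2 * taul / 2 ->
  eta / k + 3 * M * eta / k ^+ 3 + 2 * `|z| * eta <= eps ->
  (hi * M / b + 2 * hi ^+ 4 * tauh / b ^+ 2 + 4 * hi ^+ 3 * M + 2 / kap) * s <= eps * eta ^+ 2 ->
  C / lo * `|Num.sqrt (m1%:R / n%:R * (1 - m1%:R / n%:R)) - Num.sqrt (kappa * (1 - kappa))| <= eps ->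
  `|power_mean X m1 alpha - Phi (zquantile alpha + n%:R * Num.sqrt (kappa * (1 - kappa)) *
      dotp mu mu / Num.sqrt (\tr (S *m S)))| <= 3 * eps.
Proof.
move=> halpha taul0 C0 b0 kap0 tauh0 dl dh km1 bm2 qC s M k z s1 skap hMs eta0 eta4 eta3 Ke Ve Ce.
have [tS posS _] := hP.
have n0 : (0 < n)%N by case/andP: m1n => _; exact: leq_ltn_trans.
have np : 0 < n%:R :> R by rewrite ltr0n.
have m10 : (0 < m1)%N by case/andP: m1n.
have m1p : 0 < m1%:R :> R by rewrite ltr0n.
have m1len : (m1 <= n)%N by case/andP: m1n => _ /ltnW.
have m2p : 0 < (n - m1)%:R :> R by rewrite ltr0n subn_gt0; case/andP: m1n.
have m2n : (n - m1)%:R <= n%:R :> R by rewrite ler_nat leq_subr.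
have dp : 0 < d%:R :> R by apply: lt_le_trans dl; rewrite mulr_gt0.
have s0 : 0 <= s by exact: sqrtr_ge0.
have M0 : 0 <= M by rewrite mulr_ge0 ?sqrtr_ge0.
have q0 : 0 <= dotp mu mu by apply: sumr_ge0 => i _; rewrite -expr2 sqr_ge0.
have sE : s ^+ 2 = n%:R^-1 by rewrite sqr_sqrtr// invr_ge0 ltW.
have qM : dotp mu mu <= M * s.
  apply: le_trans qC _; rewrite sqrt_natr_div// /M -!mulrA ler_wpM2l// ler_wpM2r//.
  by rewrite ler_sqrt// ler_pdivrMr.
have tr_ge := trace_sqr_ge tS lo0 hS.
have trp : 0 < \tr (S *m S) by apply: lt_le_trans tr_ge; rewrite mulr_gt0// exprn_gt0.
have k0 : 0 < k by rewrite mulr_gt0// sqrtr_gt0 divr_gt0.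
have kc : k ^+ 2 + 3 * eta <= \tr (S *m S) / (n - m1)%:R.
  apply: le_trans (_ : lo ^+ 2 * taul <= _).
    have -> : k ^+ 2 = lo ^+ 2 * taul / 2 by rewrite exprMn sqr_sqrtr ?mulrA// divr_ge0// ltW.
    by move: eta3; lra.
  rewrite ler_pdivlMr//; apply: le_trans tr_ge; rewrite -mulrA ler_wpM2l ?sqr_ge0//.
  by apply: le_trans dl; rewrite ler_wpM2l// ltW.
have muq : quadform S mu <= eta.
  by apply: le_trans (quadform_hi tS hS mu) _; apply: le_trans hMs; rewrite ler_wpM2l// ltW.
have m1eta : m1%:R^-1 <= eta.
  apply: le_trans skap; rewrite mulrC; apply: le_trans (_ : kap^-1 * n%:R^-1 <= _).
    by rewrite -invfM lef_pV2 ?posrE ?mulr_gt0.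
  by rewrite ler_wpM2l ?invr_ge0 ?(ltW kap0)// -sE expr2 ler_piMr.
have pM : Num.sqrt m1%:R * dotp mu mu <= M.
  apply: le_trans (_ : Num.sqrt n%:R * (M * s) <= _).
    by apply: ler_pM => //; rewrite ?sqrtr_ge0// ler_sqrt ?ler_nat// ltW.
  by rewrite mulrCA /s sqrtrV ?(ltW np)// mulfV ?mulr1 ?gt_eqF ?sqrtr_gt0.
have := rejection_probability_bound m1n hX hP lo0 hi0 hS z eta0 eta4 m1eta muq k0 kc pM.
rewrite -power_meanE; set pw := power_mean _ _ _.
set V := (X in X / eta ^+ 2); set dls := _ / Num.sqrt _ => bound.
have VE : V / eta ^+ 2 <= eps.
  rewrite ler_pdivrMr ?exprn_gt0//; apply: le_trans Ve.
  by apply: variance_rate => //; exact: ltW.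
set dl' := _ / Num.sqrt (\tr _).
have zE : z = - zquantile alpha by rewrite /z zquantileN.
have dlE : `|dls - dl'| <= eps.
  apply: le_trans Ce.
  have -> : dls - dl' = (n%:R * dotp mu mu / Num.sqrt (\tr (S *m S))) *
     (Num.sqrt (m1%:R / n%:R * (1 - m1%:R / n%:R)) - Num.sqrt (kappa * (1 - kappa))).
    rewrite /dls /dl' [RHS]mulrBr; congr (_ - _); last by ring.
    have -> : 1 - m1%:R / n%:R = (n - m1)%:R / n%:R :> R by rewrite natrB//; field; rewrite gt_eqF.
    have -> : m1%:R / n%:R * ((n - m1)%:R / n%:R) = m1%:R * (n - m1)%:R / n%:R ^+ 2 :> R.
      by field; rewrite gt_eqF.
    rewrite !sqrtrM ?ltW ?mulr_gt0// !sqrtrV ?exprn_ge0 ?(ltW np) ?(ltW m2p)// sqrtr_sqr ger0_norm ?(ltW np)//.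
    by field; rewrite !gt_eqF ?sqrtr_gt0.
  rewrite normrM ler_wpM2r// ger0_norm ?divr_ge0 ?mulr_ge0 ?sqrtr_ge0 ?(ltW np)//.
  rewrite ler_pdivrMr ?sqrtr_gt0//.
  apply: le_trans (_ : C * Num.sqrt d%:R <= _).
    by rewrite mulrC -ler_pdivlMr// -mulrA.
  rewrite -mulrA ler_wpM2l// ler_pdivlMl//.
  rewrite -[X in X * _](ger0_norm (ltW lo0)) -sqrtr_sqr -sqrtrM ?sqr_ge0//.
  by rewrite ler_sqrt// ltW.
have lip (u v : R) : `|Phi u - Phi v| <= `|u - v|.
  wlog uv : u v / v <= u.
    by case: (leP v u) => [/[swap]/[apply]//|/ltW uv /(_ v u uv)]; rewrite distrC (distrC v).
  by rewrite !ger0_norm ?subr_ge0 ?Phi_mono// Phi_lipschitz.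
have -> : pw - Phi (zquantile alpha + dl') =
    (pw - Phi (dls - z)) + (Phi (dls - z) - Phi (zquantile alpha + dl')) by ring.
apply: le_trans (ler_normD _ _) _.
have h2 : `|Phi (dls - z) - Phi (zquantile alpha + dl')| <= eps.
  apply: le_trans (lip _ _) _; rewrite zE opprK.
  by rewrite (_ : _ - _ = dls - dl'); [|ring].
have -> : 3 * eps = (eps + eps) + eps by ring.
apply: lerD => //; apply: le_trans bound _; exact: lerD.
Qed.

End OneSampleSize.

(** * Passage to the limit *)

Section Asymptotics.
Variable R : realType.

Lemma near_sqrt_natV_le (r : R) : 0 < r -> \forall n \near \oo, Num.sqrt n%:R^-1 <= r.
Proof.
move=> r0; near=> n.
have r2 : 0 < r ^+ 2 by rewrite exprn_gt0.
have np : 0 < n%:R :> R by rewrite ltr0n; near: n; exact: nbhs_infty_gt.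
rewrite -[leRHS](ger0_norm (ltW r0)) -sqrtr_sqr ler_sqrt ?(ltW r2)//.
rewrite -[leRHS]invrK lef_pV2 ?posrE ?invr_gt0//.
by near: n; exact: nbhs_infty_ger.
Unshelve. all: by end_near. Qed.

Lemma near_cvg_between (u : nat -> R) (l a b : R) : u n @[n --> \oo] --> l ->
  a < l -> l < b -> \forall n \near \oo, a <= u n <= b.
Proof.
move=> ul al lb; near=> n; apply/andP; split.
- by apply: ltW; near: n; exact: (cvgr_gt l).
- by apply: ltW; near: n; exact: (cvgr_lt l).
Unshelve. all: by end_near. Qed.

End Asymptotics.

Lemma power_mean_cvg (R : realType) (alpha : R) (halpha : 0 < alpha < 1)
  (d m1 : nat -> nat)
  (disp : nat -> measure_display)
  (T : forall n : nat, measurableType (disp n))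
  (Pr : forall n : nat, probability (T n) R)
  (P : forall n : nat, probability ((d n).-tuple R) R)
  (X : forall n : nat, 'I_n -> {RV (Pr n) >-> (d n).-tuple R})
  (mu : forall n : nat, (d n).-tuple R)
  (Sigma : forall n : nat, 'M[R]_(d n))
  (lambda_lo lambda_hi tau kappa : R)
  (hm1 : forall n : nat, (2 <= n)%N -> (0 < m1 n < n)%N)
  (hX : forall n : nat, (2 <= n)%N -> iid_sample (X n) (P n))
  (hP : forall n : nat, (2 <= n)%N -> is_mvnormal (P n) (mu n) (Sigma n))
  (hlambda_lo : 0 < lambda_lo) (hlambda_hi : 0 < lambda_hi)
  (hSigma : forall n : nat, (2 <= n)%N ->
     forall a : R, eigenvalue (Sigma n) a -> lambda_lo <= a <= lambda_hi)
  (hmu : (fun n : nat => dotp (mu n) (mu n)) =O_\oo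
         (fun n : nat => Num.sqrt (d n)%:R / n%:R))
  (htau : 0 < tau)
  (hd_tau : (d n)%:R / n%:R @[n --> \oo] --> tau)
  (hkappa : 0 < kappa < 1)
  (hm1_kappa : (m1 n)%:R / n%:R @[n --> \oo] --> kappa) :
  (power_mean (X n) (m1 n) alpha
     - Phi (zquantile alpha
            + n%:R * Num.sqrt (kappa * (1 - kappa)) * dotp (mu n) (mu n)
              / Num.sqrt (\tr (Sigma n *m Sigma n)))) @[n --> \oo] --> (0 : R).
Proof.
have /eqO_exP[C C0 hC] := hmu.
have [kap0 kap1] := andP hkappa.
set lo := lambda_lo in hlambda_lo hSigma; set hi := lambda_hi in hlambda_hi hSigma.
pose taul := tau / 2; pose tauh := 2 * tau; pose b := (1 - kappa) / 2; pose kap := kappa / 2.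
have taul0 : 0 < taul by rewrite divr_gt0.
have tauh0 : 0 < tauh by rewrite mulr_gt0.
have b0 : 0 < b by rewrite divr_gt0// subr_gt0.
have kapp : 0 < kap by rewrite divr_gt0.
pose M := C * Num.sqrt tauh; pose k := lo * Num.sqrt (taul / 2).
pose z : R := zquantile (1 - alpha).
have M0 : 0 < M by rewrite mulr_gt0// sqrtr_gt0.
have k0 : 0 < k by rewrite mulr_gt0// sqrtr_gt0 divr_gt0.
pose K := k^-1 + 3 * M / k ^+ 3 + 2 * `|z|.
have K0 : 0 < K.
  have h1 : 0 < k^-1 by rewrite invr_gt0.
  have h2 : 0 <= 3 * M / k ^+ 3.
    by apply: divr_ge0; [apply: mulr_ge0 => //; exact: ltW|apply: exprn_ge0; exact: ltW].
  have h3 : 0 <= 2 * `|z| by apply: mulr_ge0.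
  exact: ltr_wpDr h3 (ltr_wpDr h2 h1).
pose D := hi * M / b + 2 * hi ^+ 4 * tauh / b ^+ 2 + 4 * hi ^+ 3 * M + 2 / kap.
have D0 : 0 < D.
  by apply: addr_gt0; [apply: addr_gt0; [apply: addr_gt0|]|];
    do ?[exact: exprn_gt0|apply: divr_gt0|apply: mulr_gt0|done];
    rewrite ?sqrtr_gt0 ?subr_gt0.
have lot : 0 < lo ^+ 2 * taul / 6 by rewrite divr_gt0// mulr_gt0// exprn_gt0.
apply/cvgr0Pnorm_le => eps' eps'0.
pose eps := eps' / 3; have eps0 : 0 < eps by rewrite divr_gt0.
(* [eta] meets the smallness requirements that do not involve [n]. *)
pose eta := Num.min (1 / 4) (Num.min (lo ^+ 2 * taul / 6) (eps / K)).
have eta0 : 0 < eta by rewrite /eta !lt_min lot !divr_gt0.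
have /and3P[eta1 eta2 eta3] : [&& eta <= 1 / 4, eta <= lo ^+ 2 * taul / 6 & eta <= eps / K].
  by rewrite -!le_min.
have hr : (Num.sqrt ((m1 n)%:R / n%:R * (1 - (m1 n)%:R / n%:R))) @[n --> \oo] -->
    Num.sqrt (kappa * (1 - kappa)).
  apply: (@continuous_cvg _ _ _ _ _ _ Num.sqrt); first exact: sqrt_continuous.
  by apply: cvgM => //; apply: cvgB => //; exact: cvg_cst.
have hr_eps : \forall n \near \oo, `|Num.sqrt (kappa * (1 - kappa)) -
    Num.sqrt ((m1 n)%:R / n%:R * (1 - (m1 n)%:R / n%:R))| <= eps * lo / C.
  by move/cvgrPdist_le : (hr); apply; rewrite divr_gt0// mulr_gt0.
have hd1 : \forall n \near \oo, taul <= (d n)%:R / n%:R <= tauh.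
  by apply: (near_cvg_between hd_tau); rewrite /taul /tauh; lra.
have hk1 : \forall n \near \oo, kap <= (m1 n)%:R / n%:R <= 1 - b.
  by apply: (near_cvg_between hm1_kappa); rewrite /kap /b; lra.
have hiM : 0 < (hi * M)^-1 * eta.
  by apply: mulr_gt0 => //; rewrite invr_gt0; apply: mulr_gt0.
have hiM0 : 0 < hi * M by apply: mulr_gt0.
near=> n.
have n2 : (2 <= n)%N by near: n; exact: nbhs_infty_ge.
have np : 0 < n%:R :> R by rewrite ltr0n (leq_trans _ n2).
have /andP[d1 d2] : taul <= (d n)%:R / n%:R <= tauh.
  by near: n; exact: hd1.
have /andP[k1 k2] : kap <= (m1 n)%:R / n%:R <= 1 - b.
  by near: n; exact: hk1.
have -> : eps' = 3 * eps by rewrite /eps; field.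
have m1n := hm1 n n2; have m1len : (m1 n <= n)%N by case/andP: m1n => _ /ltnW.
have m2E : (n - m1 n)%:R = n%:R - (m1 n)%:R :> R by rewrite natrB.
have dl : taul * n%:R <= (d n)%:R by rewrite -ler_pdivlMr.
have dh : (d n)%:R <= tauh * n%:R by rewrite -ler_pdivrMr.
have km1 : kap * n%:R <= (m1 n)%:R by rewrite -ler_pdivlMr.
have bm2 : b * n%:R <= (n - m1 n)%:R.
  rewrite m2E lerBrDr -lerBrDl -[X in X - _]mul1r -mulrBl -ler_pdivrMr//.
have q0 : 0 <= dotp (mu n) (mu n) by apply: sumr_ge0 => i _; rewrite -expr2 sqr_ge0.
have qC : dotp (mu n) (mu n) <= C * (Num.sqrt (d n)%:R / n%:R).
  rewrite -[leLHS](ger0_norm q0) -[X in _ <= _ * X]ger0_norm ?divr_ge0 ?sqrtr_ge0//.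
  by near: n; exact: hC.
have s1 : Num.sqrt n%:R^-1 <= (1 : R).
  by near: n; exact: (near_sqrt_natV_le ltr01).
have skap : Num.sqrt n%:R^-1 / kap <= eta.
  rewrite ler_pdivrMr//.
  by near: n; apply: near_sqrt_natV_le; exact: mulr_gt0.
have hMs : hi * (M * Num.sqrt n%:R^-1) <= eta.
  rewrite mulrA -ler_pdivlMl//.
  by near: n; exact: near_sqrt_natV_le.
have Ve : D * Num.sqrt n%:R^-1 <= eps * eta ^+ 2.
  rewrite -ler_pdivlMl//.
  by near: n; apply: near_sqrt_natV_le; rewrite mulr_gt0 ?invr_gt0// mulr_gt0// exprn_gt0.
have eta4 : 4 * eta <= 1 by rewrite mulrC -ler_pdivlMr.
have etalo : 3 * eta <= lo ^+ 2 * taul / 2.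
  by move: eta2; set u := lo ^+ 2 * taul; lra.
have Ke : eta / k + 3 * M * eta / k ^+ 3 + 2 * `|z| * eta <= eps.
  have -> : eta / k + 3 * M * eta / k ^+ 3 + 2 * `|z| * eta = eta * K by rewrite /K; ring.
  by rewrite -ler_pdivlMr.
have Ce : C / lo * `|Num.sqrt ((m1 n)%:R / n%:R * (1 - (m1 n)%:R / n%:R)) -
     Num.sqrt (kappa * (1 - kappa))| <= eps.
  rewrite mulrC -ler_pdivlMr ?divr_gt0// invf_div mulrA distrC.
  by near: n; exact: hr_eps.
exact: (power_near_limit m1n (hX n n2) (hP n n2) hlambda_lo hlambda_hi (hSigma n n2)
  halpha taul0 (ltW C0) b0 kapp (ltW tauh0) dl dh km1 bm2 qC s1 skap hMs eta0 eta4 etalo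
  Ke Ve Ce).
Unshelve. all: by end_near. Qed.

Lemma power_transfer (R : realType) (eps u v p p' : R) :
  u <= v -> `|p' - u| <= eps / 2 -> `|p - v| <= eps / 2 -> p' <= p + eps.
Proof. by move=> uv; rewrite !ler_norml => /andP[_ ?] /andP[? _]; lra. Qed.

Theorem theorem2p6 (R : realType) (alpha : R) (halpha : 0 < alpha < 1)
  (d m1 : nat -> nat)
  (disp : nat -> measure_display)
  (T : forall n : nat, measurableType (disp n))
  (Pr : forall n : nat, probability (T n) R)
  (P : forall n : nat, probability ((d n).-tuple R) R)
  (X : forall n : nat, 'I_n -> {RV (Pr n) >-> (d n).-tuple R})
  (mu : forall n : nat, (d n).-tuple R)
  (Sigma : forall n : nat, 'M[R]_(d n))
  (lambda_lo lambda_hi tau kappa : R)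
  (hd : forall n : nat, (2 <= n)%N -> (0 < d n)%N)
  (hm1 : forall n : nat, (2 <= n)%N -> (0 < m1 n < n)%N)
  (hX : forall n : nat, (2 <= n)%N -> iid_sample (X n) (P n))
  (hP : forall n : nat, (2 <= n)%N -> is_mvnormal (P n) (mu n) (Sigma n))
  (hlambda_lo : 0 < lambda_lo) (hlambda_hi : 0 < lambda_hi)
  (hSigma : forall n : nat, (2 <= n)%N ->
     forall a : R, eigenvalue (Sigma n) a -> lambda_lo <= a <= lambda_hi)
  (hmu : (fun n : nat => dotp (mu n) (mu n)) =O_\oo
         (fun n : nat => Num.sqrt (d n)%:R / n%:R))
  (htau : 0 < tau)
  (hd_tau : (d n)%:R / n%:R @[n --> \oo] --> tau)
  (hkappa : 0 < kappa < 1)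
  (hm1_kappa : (m1 n)%:R / n%:R @[n --> \oo] --> kappa) :
  (power_mean (X n) (m1 n) alpha
     - Phi (zquantile alpha
            + n%:R * Num.sqrt (kappa * (1 - kappa)) * dotp (mu n) (mu n)
              / Num.sqrt (\tr (Sigma n *m Sigma n)))) @[n --> \oo] --> (0 : R)
  /\
  (kappa = 1 / 2 ->
   forall (m1' : nat -> nat) (kappa' : R),
     (forall n : nat, (2 <= n)%N -> (0 < m1' n < n)%N) ->
     0 < kappa' < 1 ->
     (m1' n)%:R / n%:R @[n --> \oo] --> kappa' ->
     forall eps : R, 0 < eps ->
       \forall n \near \oo,
         power_mean (X n) (m1' n) alpha <= power_mean (X n) (m1 n) alpha + eps).
Proof.
have part1 := @power_mean_cvg R alpha halpha d _ disp T Pr P X mu Sigma lambda_lo lambda_hi tau _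
  _ hX hP hlambda_lo hlambda_hi hSigma hmu htau hd_tau.
split; first exact: part1.
move=> kappaE m1' kappa' hm1' hkappa' hm1'_kappa' eps eps0.
have /cvgr0Pnorm_le/(_ (eps / 2)) c1 := part1 _ _ hm1 hkappa hm1_kappa.
have /cvgr0Pnorm_le/(_ (eps / 2)) c2 := part1 _ _ hm1' hkappa' hm1'_kappa'.
have e2 : 0 < eps / 2 by rewrite divr_gt0.
near=> n.
have b1 : `|power_mean (X n) (m1 n) alpha - Phi (zquantile alpha +
    n%:R * Num.sqrt (kappa * (1 - kappa)) * dotp (mu n) (mu n)
      / Num.sqrt (\tr (Sigma n *m Sigma n)))| <= eps / 2 by near: n; exact: c1.
have b2 : `|power_mean (X n) (m1' n) alpha - Phi (zquantile alpha +
    n%:R * Num.sqrt (kappa' * (1 - kappa')) * dotp (mu n) (mu n)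
      / Num.sqrt (\tr (Sigma n *m Sigma n)))| <= eps / 2 by near: n; exact: c2.
have kk : kappa' * (1 - kappa') <= kappa * (1 - kappa).
  rewrite -subr_ge0 kappaE; have -> : 1 / 2 * (1 - 1 / 2) - kappa' * (1 - kappa') = (kappa' - 1 / 2) ^+ 2 :> R by field.
  exact: sqr_ge0.
have q0 : 0 <= dotp (mu n) (mu n) by apply: sumr_ge0 => i _; rewrite -expr2 sqr_ge0.
have h : Phi (zquantile alpha + n%:R * Num.sqrt (kappa' * (1 - kappa')) * dotp (mu n) (mu n)
      / Num.sqrt (\tr (Sigma n *m Sigma n))) <=
    Phi (zquantile alpha + n%:R * Num.sqrt (kappa * (1 - kappa)) * dotp (mu n) (mu n)
      / Num.sqrt (\tr (Sigma n *m Sigma n))).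
  apply: Phi_mono; rewrite lerD2l ler_wpM2r ?invr_ge0 ?sqrtr_ge0// ler_wpM2r//.
  by rewrite ler_wpM2l// ler_wsqrtr.
exact: power_transfer h b2 b1.
Unshelve. all: by end_near. Qed.
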